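(* $\mathrm{cov}(\mathcal{M})\le\mathfrak{ge}(\mathrm{Laver})$, $\mathrm{non}(\mathcal{NA})\le\mathfrak{ge}(\mathrm{Laver})$, $\mathfrak{ge}(\mathrm{Laver})\le\mathrm{non}(\mathcal{SN})$ and $\mathfrak{ge}(\mathrm{Laver})\le\max\{\mathrm{non}(\mathcal{E}),\mathfrak{d}\}$.
   Context: Let $\mathbb{Q}$ denote the set of those $x\in 2^\omega$ that are eventually zero: $\exists n\,\forall m\ge n:\ x(m)=0$. For $A\subseteq 2^\omega$ and $n\in\omega$, $\mathrm{level}_A(n):=|\{h|_n : h\in A\}|$. Let $\mathcal{H}$ be the set of non-decreasing, unbounded $f\in\omega^\omega$ with $f(n)\le n$ for all $n$. For $f\in\mathcal{H}$ let $\mathcal{I}_f:=\{A\subseteq\mathbb{Q} : \forall d>0:\ \mathrm{level}_A\le^{\ast}\tfrac1d f\}$, an ideal on $\mathbb{Q}$ (where $\le^{\ast}$ means $\le$ at all but finitely many arguments). For an ideal $\mathcal{I}$ on a countable set $X$, with $\mathcal{I}^+=\mathcal{P}(X)\setminus\mathcal{I}$, $$\mathfrak{ge}(\mathcal{I})=\min\{|\mathcal{F}| : \mathcal{F}\subseteq\mathcal{I}^+ \text{ is a filter base, and } \forall I\in\mathcal{I}\ \exists F\in\mathcal{F}\ (|I\cap F|<\omega)\}.$$ Define $\mathfrak{ge}(\mathrm{Laver}):=\min\{\mathfrak{ge}(\mathcal{I}_f) : f\in\mathcal{H}\}$. Other cardinal characteristics: $\mathrm{cov}(\mathcal{M})$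 is the least number of meager sets covering $2^\omega$. With $\mathcal{N}$ the ideal of measure zero subsets of $2^\omega$, a set $X\subseteq 2^\omega$ is null-additive if $X+N\in\mathcal{N}$ for all $N\in\mathcal{N}$ ($+$ is coordinatewise addition mod $2$); $\mathrm{non}(\mathcal{NA})$ is the smallest cardinality of a subset of $2^\omega$ that is not null-additive. $\mathcal{SN}$ is the ideal of strong measure zero subsets of $2^\omega$ and $\mathrm{non}(\mathcal{SN})$ is the smallest cardinality of a subset of $2^\omega$ that is not strong measure zero. $\mathcal{E}$ is the $\sigma$-ideal generated by the subsets of $2^\omega$ with closure of measure zero, and $\mathrm{non}(\mathcal{E})$ is the smallest cardinality of a subset of $2^\omega$ not in $\mathcal{E}$. $\mathfrak{d}=\min\{|\mathcal{F}| : \mathcal{F}\subseteq\omega^\omega,\ \forall g\in\omega^\omega\ \exists f\in\mathcal{F}:\ g\le^{\ast}f\}$. *)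

(* Defs.v *)
From HB Require Import structures.
From mathcomp Require Import all_boot all_order all_algebra.
From mathcomp Require Import finmap.
From mathcomp Require Import all_classical all_reals all_analysis.
Set Implicit Arguments.
Unset Strict Implicit.
Unset Printing Implicit Defensive.
Import Order.TTheory GRing.Theory Num.Theory.
Local Open Scope classical_set_scope.
Local Open Scope ring_scope.
Local Open Scope card_scope.

(* A cardinal is represented by a set having that cardinality, and cardinals
   are compared with [#<=]. *)

(* Given a nonempty collection C of sets, [cardinal_min C] is a member of C of least
   cardinality (see [cardinal_minP]), hence a representative of min {|A| : A in C}.
   It is the empty set when C is empty. *)
Definition cardinal_min T (C : set (set T)) : set T :=
  xget set0 [set A | C A /\ forall B, C B -> A #<= B].

Lemma cardinal_minP T (C : set (set T)) : C !=set0 ->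
  C (cardinal_min C) /\ forall B, C B -> cardinal_min C #<= B.
Proof.
move=> [A0 CA0]; rewrite /cardinal_min.
suff ex : exists A, C A /\ forall B, C B -> A #<= B.
  exact: (@xgetPex _ set0 [set A | C A /\ forall B, C B -> A #<= B] ex).
(* Zorn applied to the sets S of choice functions on C whose evaluations at the
   members of C are all injective: if S is maximal, one of these evaluations is
   onto, and composing it with the others gives the required injections. *)
pose P (S : set (set T -> T)) :=
  (forall g A, S g -> C A -> A (g A)) /\
  (forall g h A, S g -> S h -> C A -> g A = h A -> g = h).
have [|S [[S1 S2] Smax]] := @Zorn_bigcup _ P.
  move=> F FP Ftot; split=> [g A [X FX Xg] CA|g h A [X FX Xg] [Y FY Yh] CA].
    by have [inX _] := FP _ FX; exact: (inX g A Xg CA).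
  have [XY|YX] := Ftot _ _ FX FY.
    by have [_ injY] := FP _ FY; apply: (injY _ _ A) => //; exact: XY.
  by have [_ injX] := FP _ FX; apply: (injX _ _ A) => //; exact: YX.
have [[A [CA SA]]|nex] := pselect (exists A, C A /\
    A `<=` [set g A | g in S]).
  exists A; split=> // B CB.
  apply: (card_le_trans (subset_card_le SA)).
  apply: (card_le_trans (card_image_le _ _)).
  have inj : {in S &, injective (fun g : set T -> T => g B)}.
    by move=> g h /set_mem Sg /set_mem Sh; exact: (S2 _ _ B).
  have /card_eqPle[_ le] := inj_card_eq inj.
  apply: (card_le_trans le); apply: subset_card_le => _ [g Sg <-].
  exact: (S1 _ _ Sg CB).
have fresh A : C A -> exists t, A t /\ forall g, S g -> g A <> t.
  move=> CA; apply: contrapT => nt; apply: nex; exists A; split=> // t At.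
  apply: contrapT => nS; apply: nt; exists t; split=> // g Sg gt.
  by apply: nS; exists g.
have [t0 _] := fresh _ CA0.
have [g0 g0P] : exists g0 : set T -> T,
    forall A, C A -> A (g0 A) /\ forall g, S g -> g A <> g0 A.
  suff /choice[g0 g0P] : forall A, exists t,
      C A -> A t /\ forall g, S g -> g A <> t by exists g0.
  move=> A; have [CA|nCA] := pselect (C A); last by exists t0.
  by have [t tP] := fresh _ CA; exists t.
exfalso; apply: (Smax (S `|` [set g0])).
  split; first by left.
  move=> /(_ g0 (or_intror erefl)) Sg0.
  by have [_ /(_ _ Sg0)] := g0P _ CA0.
split=> [g A [Sg|->] CA|g h A [Sg|->] [Sh|->] CA] //.
- exact: (S1 _ _ Sg CA).
- by have [] := g0P _ CA.
- exact: (S2 _ _ A).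
- by have [_ /(_ _ Sg)] := g0P _ CA.
- by have [_ /(_ _ Sh)/nesym] := g0P _ CA.
Qed.

Definition cardinal_max T U (A : set T) (B : set U) : set (T + U) :=
  if A #<= B then inr @` B else inl @` A.

Definition non T (J : set (set T)) : set T := cardinal_min [set X | ~ J X].

Definition prefix_of (x : cantor_space) (n : nat) : seq bool := mkseq x n.

Definition cylinder (s : seq bool) : set cantor_space :=
  [set x | prefix_of x (size s) = s].

(* Outer measure of the product (fair coin tossing) measure on 2^omega, in which
   the cylinder of s has measure 2 ^ - size s. *)
Definition coin_outer (R : realType) (A : set cantor_space) : \bar R :=
  ereal_inf [set (\sum_(0 <= k <oo) (2^-1 ^+ size (s k))%:E)%E
            | s in [set s : nat -> seq bool |
                    A `<=` \bigcup_k cylinder (s k)]].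

Definition null (R : realType) : set (set cantor_space) :=
  [set A | coin_outer R A = 0%E].

Definition cantor_add (x y : cantor_space) : cantor_space :=
  fun n => x n (+) y n.

Definition null_additive (R : realType) : set (set cantor_space) :=
  [set X | forall N, null R N ->
           null R [set cantor_add x y | x in X & y in N]].

Definition strong_measure_zero : set (set cantor_space) :=
  [set X | forall f : nat -> nat, exists2 s : nat -> seq bool,
           forall n, size (s n) = f n & X `<=` \bigcup_n cylinder (s n)].

Definition sigma_ideal T (J : set (set T)) : Prop :=
  [/\ J set0, forall A B, A `<=` B -> J B -> J A
    & forall A : nat -> set T, (forall n, J (A n)) -> J (\bigcup_n A n)].

Definition idealE (R : realType) : set (set cantor_space) :=
  smallest (@sigma_ideal cantor_space) [set A | null R (closure A)].

Definition nowhere_dense (T : topologicalType) (A : set T) : Prop :=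
  interior (closure A) = set0.

Definition meager (T : topologicalType) : set (set T) :=
  [set A | exists2 F : nat -> set T,
           forall n, nowhere_dense (F n) & A = \bigcup_n F n].

Definition cov_meager : set (set cantor_space) :=
  cardinal_min [set F : set (set cantor_space) |
            F `<=` @meager cantor_space /\ \bigcup_(A in F) A = setT].

Definition dominating_number : set (nat -> nat) :=
  cardinal_min [set F : set (nat -> nat) |
            forall g, exists2 f, F f & \forall n \near \oo, (g n <= f n)%N].

Definition filter_base T (F : set (set T)) : Prop :=
  [/\ F !=set0, ~ F set0
    & forall A B, F A -> F B -> exists2 C, F C & C `<=` A `&` B].

(* ge(I) for an ideal I on the set X; here I^+ = P(X) \ I. *)
Definition ge_ideal T (X : set T) (I : set (set T)) : set (set T) :=
  cardinal_min [set F | [/\ forall A, F A -> A `<=` X /\ ~ I A,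
                        filter_base F
                      & forall A, I A -> exists2 B, F B
                                       & finite_set (A `&` B)]].

Definition QQ : set cantor_space :=
  [set x | exists n, forall m, (n <= m)%N -> x m = false].

(* The image is a set of bit strings of length n, hence finite, so [fset_set] is
   meaningful. *)
Definition level (A : set cantor_space) (n : nat) : nat :=
  #|` fset_set [set prefix_of h n | h in A] |%fset.

Definition HH : set (nat -> nat) :=
  [set f | [/\ {homo f : m n / (m <= n)%N},
               forall k, exists n, (k < f n)%N
             & forall n, (f n <= n)%N]].

Definition ideal_of (R : realType) (f : nat -> nat) : set (set cantor_space) :=
  [set A | A `<=` QQ /\
           forall d : R, 0 < d ->
             \forall n \near \oo, (level A n)%:R <= d^-1 * (f n)%:R].

Definition ge_Laver (R : realType) : set (set cantor_space) :=
  cardinal_min [set ge_ideal QQ (ideal_of R f) | f in HH].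

(* Main.v *)
Require Import Defs.
From mathcomp Require Import all_boot all_order all_algebra.
From mathcomp Require Import all_classical all_reals all_analysis.
From mathcomp Require Import zify lra.
Set Implicit Arguments.
Unset Strict Implicit.
Unset Printing Implicit Defensive.
Import Order.TTheory GRing.Theory Num.Theory.
Local Open Scope classical_set_scope.
Local Open Scope card_scope.

(** Write I_f for the ideal of a function f, and call a set of rationals
    positive when it is not in I_f.

    Lower bounds.  Let F be a filter base of positive sets that witnesses
    ge(I_f).  Its members are infinite, so by compactness they all accumulate at
    one point y of the Cantor space ([positive_base_clusters]), and F is
    contradicted by any A in I_f that meets every member of F in points
    arbitrarily close to y ([no_clustering_member]).  Membership in I_f is
    cheap: if e grows fast enough with respect to f, a set whose level on
    [e k, e (k+1)) is bounded by a prescribed b k is in I_f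
    ([ideal_of_sparse]).
    - For cov(M), a point c of the Cantor space selects terms of an enumeration
      of the rationals; the k-th selected term is kept if it agrees with y up to
      e k.  The kept terms form a set in I_f.  For each B in F, those c that keep
      only finitely many members of B other than y form a meager set, and these
      meager sets cover the Cantor space because F is a witness.
    - For non(NA), choose for each B in F points h(B,k) of B that agree with y
      up to e k, and let x(B) be a point whose j-th block codes the restrictions
      of h(B,0), ..., h(B,j) to e (j+1).  If the set of the x(B) were
      null-additive, then by one half of Shelah's characterization of
      null-additivity ([null_additive_slalom]) there would be sets S j of at most
      (j+1) 2^j codes, with almost all blocks of each x(B) guessed.  The rationals
      all of whose restrictions follow y or a guessed code then form a set in
      I_f that contains h(B,k) for almost all k.

    Upper bounds.  Both come from one coding ([ge_Laver_le_escaping]).  Cut omega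
    into blocks, the i-th of which lets a rational list i strings of length m i,
    and let f n count the blocks that end by n.  For a point x and a function d,
    take the rationals that vanish before some block j and whose i-th block lists
    the restriction of x to m i for all i in [j, d j).  Since i strings can be
    listed, finite intersections of such sets have level at least f minus a
    constant, hence are positive.  If A is in I_f, its members list at most
    (i+1)^2 strings in the i-th block, for almost all i; so A misses the set of
    (x, d) as soon as every [j, d j) contains an i where x escapes these lists.
    A set that is not of strong measure zero contains an x that escapes
    everywhere, and one that is not in E contains an x that escapes infinitely
    often; a dominating family then provides d.  Closing the family under finite
    intersections does not enlarge it, because an infinite set has as many finite
    sequences as elements ([card_seq_le]). *)

(** * Cardinal arithmetic *)

Lemma inj_on_card_le T U (A : set T) (B : set U) (f : T -> U) :
  (forall x, A x -> B (f x)) -> (forall x y, A x -> A y -> f x = f y -> x = y) ->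
  A #<= B.
Proof.
move=> fAB finj.
have /card_eqPle[_ le] : f @` A #= A.
  by apply: inj_card_eq => x y /set_mem Ax /set_mem Ay; exact: finj.
by apply: card_le_trans le _; apply: subset_card_le => _ [x Ax <-]; exact: fAB.
Qed.

Lemma card_le_inj_on T U (A : set T) (B : set U) : B !=set0 -> A #<= B ->
  exists f : T -> U, (forall x, A x -> B (f x)) /\
    (forall x y, A x -> A y -> f x = f y -> x = y).
Proof.
elim/Ppointed: U => U in B *.
  by rewrite !emptyE => -[].
move=> _ /pcard_leP; rewrite injfunPex => -[f fAB finj].
by exists f; split=> // x y Ax Ay; apply: finj; exact/mem_set.
Qed.

Lemma card_le_sum T U (A : set T) (B : set U) :
  A #<= (inl : T -> T + U) @` A /\ B #<= (inr : U -> T + U) @` B.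
Proof.
split.
  by apply: (@inj_on_card_le _ _ _ _ inl) => [x Ax|x y _ _ []//]; exists x.
by apply: (@inj_on_card_le _ _ _ _ inr) => [x Ax|x y _ _ []//]; exists x.
Qed.

(** Any nonempty collection of sets has a member of least cardinality; apply
    this to copies of the two sets inside the disjoint sum. *)
Lemma card_le_total T U (A : set T) (B : set U) : A #<= B \/ B #<= A.
Proof.
pose C : set (set (T + U)) := [set inl @` A; inr @` B].
have [|CM le] := @cardinal_minP _ C; first by exists (inl @` A); left.
have [iA iB] := card_le_sum A B.
case: CM => CM.
  left; apply: card_le_trans iA _.
  by rewrite -CM; apply: card_le_trans (le _ (or_intror erefl)) (card_image_le _ _).
right; apply: card_le_trans iB _.
by rewrite -CM; apply: card_le_trans (le _ (or_introl erefl)) (card_image_le _ _).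
Qed.

Lemma card_le_max T U (A : set T) (B : set U) :
  A #<= cardinal_max A B /\ B #<= cardinal_max A B.
Proof.
have [iA iB] := card_le_sum A B.
rewrite /cardinal_max; case: ifPn => AB; split=> //.
  exact: card_le_trans AB iB.
by have [AB'|BA] := card_le_total A B; [rewrite AB' in AB|exact: card_le_trans BA iA].
Qed.

Definition pairing_on T (Y : set T) (f : T -> T -> T) : Prop :=
  (forall a b, Y a -> Y b -> Y (f a b)) /\
  (forall a b c d, Y a -> Y b -> Y c -> Y d -> f a b = f c d -> a = c /\ b = d).

(** Zorn's lemma is applied to inclusion of graphs, so a partial pairing function
    is represented by its graph G, a set of triples ((a, b), c). *)
Definition graph_dom T (G : set ((T * T) * T)) : set T :=
  [set a | exists b c, G ((a, b), c)].

Definition square_graph T (A : set T) (G : set ((T * T) * T)) : Prop :=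
  [/\ forall a b c, G ((a, b), c) ->
        [/\ graph_dom G a, graph_dom G b & graph_dom G c] /\ A a,
      forall a b, graph_dom G a -> graph_dom G b -> exists c, G ((a, b), c),
      forall p c d, G (p, c) -> G (p, d) -> c = d
    & forall p q c, G (p, c) -> G (q, c) -> p = q].

Lemma square_graph_bigcup T (A : set T) (F : set (set ((T * T) * T))) :
  (forall X, F X -> square_graph A X) -> total_on F subset ->
  square_graph A (\bigcup_(X in F) X).
Proof.
move=> Fsq Ftot.
have dF X a : F X -> graph_dom X a -> graph_dom (\bigcup_(X in F) X) a.
  by move=> FX [b [c Xabc]]; exists b, c, X.
have join X Y : F X -> F Y -> exists Z, [/\ F Z, X `<=` Z & Y `<=` Z].
  by move=> FX FY; have [XY|YX] := Ftot _ _ FX FY; [exists Y|exists X]; split.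
split.
- move=> a b c [X FX Xabc]; have [s1 _ _ _] := Fsq _ FX.
  by have [[? ? ?] Aa] := s1 _ _ _ Xabc; do ![split=> //]; exact: dF FX _.
- move=> a b [a1 [a2 [X FX Xa]]] [b1 [b2 [Y FY Yb]]].
  have [Z [FZ XZ YZ]] := join _ _ FX FY.
  have [_ s2 _ _] := Fsq _ FZ; have [||c Zc] := s2 a b; last by exists c, Z.
    by exists a1, a2; exact: XZ.
  by exists b1, b2; exact: YZ.
- move=> p c d [X FX Xc] [Y FY Yd]; have [Z [FZ XZ YZ]] := join _ _ FX FY.
  by have [_ _ s3 _] := Fsq _ FZ; exact: s3 (XZ _ Xc) (YZ _ Yd).
- move=> p c d [X FX Xc] [Y FY Yd]; have [Z [FZ XZ YZ]] := join _ _ FX FY.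
  by have [_ _ _ s4] := Fsq _ FZ; exact: s4 (XZ _ Xc) (YZ _ Yd).
Qed.

Lemma square_graph_pairing T (A : set T) (G : set ((T * T) * T)) :
  square_graph A G -> exists2 f, pairing_on (graph_dom G) f &
    forall a b, graph_dom G a -> graph_dom G b -> G ((a, b), f a b).
Proof.
move=> [s1 s2 s3 s4].
have ex (p : T * T) : exists c, graph_dom G p.1 -> graph_dom G p.2 -> G (p, c).
  case: (pselect (graph_dom G p.1 /\ graph_dom G p.2)) => [[d1 d2]|nd].
    by case: p d1 d2 => a b /= d1 d2; have [c Gc] := s2 _ _ d1 d2; exists c.
  by exists p.1 => d1 d2; case: nd.
have [f fP] := choice ex.
have fG a b : graph_dom G a -> graph_dom G b -> G ((a, b), f (a, b)).
  by move=> da db; exact: fP (a, b) da db.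
exists (fun a b => f (a, b)) => //; split=> [a b da db|a b c d da db dc dd e].
  by have [[]] := s1 _ _ _ (fG _ _ da db).
have := fG _ _ da db; rewrite e => /s4 /(_ (fG _ _ dc dd)).
by case=> -> ->.
Qed.

(** If the complement of the domain Y contains a copy h Y of Y, a pairing of Y
    extends to one of the union of Y and h Y: the three new quarters of the square
    are sent into h Y, the tags t 1, t 2 and t 3 keeping their images apart. *)
Lemma square_graph_extend T (A : set T) (G : set ((T * T) * T)) (h : T -> T)
    (t : nat -> T) :
  square_graph A G -> (forall i, graph_dom G (t i)) -> injective t ->
  (forall a, graph_dom G a -> A (h a) /\ ~ graph_dom G (h a)) ->
  (forall a b, graph_dom G a -> graph_dom G b -> h a = h b -> a = b) ->
  exists2 H, square_graph A (G `|` H) & ~ (H `<=` G).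
Proof.
move=> sG tG tinj hA hinj; set Y := graph_dom G.
have [f [fY finj] fG] := square_graph_pairing sG.
have [s1 s2 s3 s4] := sG.
pose e (s : bool) a := if s then h a else a.
pose tag (s s' : bool) : T := t (s + s'.*2)%N.
pose v s s' a b := h (f (tag s s') (f a b)).
pose H : set ((T * T) * T) := [set p | exists s s' a b,
  [/\ Y a, Y b, s || s' & p = ((e s a, e s' b), v s s' a b)]].
have Ydom a b c : G ((a, b), c) -> [/\ Y a, Y b & Y c].
  by move=> /s1[].
have einj s s' a b : Y a -> Y b -> e s a = e s' b -> s = s' /\ a = b.
  move=> Ya Yb; case: s; case: s' => //= E.
  - by split=> //; exact: hinj.
  - by have [_] := hA a Ya; rewrite E.
  - by have [_] := hA b Yb; rewrite -E.
have Ytag s s' a b : Y a -> Y b -> Y (f (tag s s') (f a b)).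
  by move=> Ya Yb; apply: (fY); [exact: tG|exact: fY].
have vinj s s' a b r r' c d : Y a -> Y b -> Y c -> Y d ->
    v s s' a b = v r r' c d -> [/\ s = r, s' = r', a = c & b = d].
  move=> Ya Yb Yc Yd /hinj.
  move=> /(_ (Ytag _ _ _ _ Ya Yb) (Ytag _ _ _ _ Yc Yd)).
  move=> /finj[||||/tinj tE /finj[]//]; try exact: tG; try exact: (fY).
  by move=> -> ->; split=> //; case: s s' r r' tE => -[] [] [].
have vN s s' a b : Y a -> Y b -> ~ Y (v s s' a b).
  by move=> Ya Yb; have [] := hA _ (Ytag s s' _ _ Ya Yb).
have Yt0 : Y (t 0) by exact: tG.
have full s s' a b : Y a -> Y b -> exists c, (G `|` H) ((e s a, e s' b), c).
  move=> Ya Yb; case: (boolP (s || s')) => ss.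
    by exists (v s s' a b); right; exists s, s', a, b.
  case: s s' ss => -[] //= _; have [c Gc] := s2 _ _ Ya Yb.
  by exists c; left.
have dome s a : Y a -> graph_dom (G `|` H) (e s a).
  by move=> Ya; have [c Hc] := full s true _ _ Ya Yt0; exists (e true (t 0)), c.
have domI a : graph_dom (G `|` H) a -> exists s b, Y b /\ a = e s b.
  move=> [b [c [Gc|[s [s' [a' [b' [Ya Yb _ [-> _ _]]]]]]]]].
    by exists false, a; have [] := Ydom _ _ _ Gc.
  by exists s, a'.
exists H; last first.
  move=> /(_ ((e true (t 0), e true (t 0)), v true true (t 0) (t 0))) HG.
  have /HG/Ydom[] : H ((e true (t 0), e true (t 0)), v true true (t 0) (t 0)).
    by exists true, true, (t 0), (t 0).
  by have [] := hA _ Yt0.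
split.
- move=> a b c [Gc|[s [s' [a' [b' [Ya Yb _ [-> -> ->]]]]]]].
    have [[Ya Yb Yc] Aa] := s1 _ _ _ Gc; split=> //; split.
    + exact: dome false _ Ya.
    + exact: dome false _ Yb.
    + exact: dome false _ Yc.
  split; first by split; [exact: dome|exact: dome|
    exact: (dome true _ (Ytag _ _ _ _ Ya Yb))].
  case: s => /=; first by have [] := hA _ Ya.
  by have [w Gw] := s2 _ _ Ya Yb; have [] := s1 _ _ _ Gw.
- by move=> _ _ /domI[s [a [Ya ->]]] /domI[s' [b [Yb ->]]]; exact: full.
- move=> p c d [Gc|[s [s' [a [b [Ya Yb ss [-> ->]]]]]]].
    case=> [Gd|[s [s' [a [b [Ya Yb ss [E ->]]]]]]]; first exact: s3 Gc Gd.
    case: p E Gc => p q [-> ->] /Ydom[Ea Eb _]; exfalso.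
    have [_ nA] := hA _ Ya; have [_ nB] := hA _ Yb.
    by move: ss Ea Eb; case: (s) => //=; case: (s').
  case=> [/Ydom[Ea Eb _]|[r [r' [a' [b' [Ya' Yb' _ [E1 E2 ->]]]]]]].
    exfalso; have [_ nA] := hA _ Ya; have [_ nB] := hA _ Yb.
    by move: ss Ea Eb; case: (s) => //=; case: (s').
  have [-> ->] := einj _ _ _ _ Ya Ya' E1.
  by have [-> ->] := einj _ _ _ _ Yb Yb' E2.
- move=> p q c [Gc|[s [s' [a [b [Ya Yb ss [-> ->]]]]]]].
    case=> [Gd|[s [s' [a [b [Ya Yb ss [_ E]]]]]]]; first exact: s4 Gc Gd.
    case: p Gc => p p' /Ydom[_ _]; rewrite E => Yv.
    by case: (vN s s' _ _ Ya Yb).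
  case=> [|[r [r' [a' [b' [Ya' Yb' _ [-> E]]]]]]].
    by case: q => q q' /Ydom[_ _] Yv; case: (vN s s' _ _ Ya Yb).
  by have [-> -> -> ->] := vinj _ _ _ _ _ _ _ _ Ya Yb Ya' Yb' E.
Qed.

Lemma pairing_transport T (A Y : set T) f : pairing_on Y f -> Y `<=` A ->
  A #<= Y -> Y !=set0 -> exists g, pairing_on A g.
Proof.
move=> [fY finj] YA AY Y0; have [k [kY kinj]] := card_le_inj_on Y0 AY.
exists (fun a b => f (k a) (k b)); split=> [a b Aa Ab|a b c d Aa Ab Ac Ad].
  by apply: YA; apply: (fY); exact: kY.
by move=> /finj[]; try exact: kY; move=> /kinj -> // /kinj ->.
Qed.

(** A maximal graph that contains the pairing of a countable subset has a domain
    Y at least as large as its complement, since otherwise it could be extended;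
    then Y is equinumerous with the whole set. *)
Lemma infinite_pairing T (A : set T) : infinite_set A ->
  exists f, pairing_on A f.
Proof.
move=> /[dup] Ainf /infiniteP natA.
have [t [tA tinj]] := card_le_inj_on (infinite_setN0 Ainf) natA.
have {}tinj : injective t by move=> i j; exact: tinj.
have {}tA i : A (t i) by exact: tA.
pose G0 : set ((T * T) * T) :=
  [set p | exists i j, p = ((t i, t j), t (pickle (i, j)))].
have domG0 i : graph_dom G0 (t i) by exists (t 0), (t (pickle (i, 0))), i, 0.
have sG0 : square_graph A G0.
  split.
  - by move=> _ _ _ [i [j [-> -> ->]]].
  - move=> _ _ [_ [_ [i [j [-> _ _]]]]] [_ [_ [k [l [-> _ _]]]]].
    by exists (t (pickle (i, k))), i, k.
  - by move=> p c d [i [j [-> ->]]] [k [l [/tinj -> /tinj -> ->]]].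
  - move=> p q c [i [j [-> ->]]] [k [l [-> /tinj]]].
    by move=> /(pcan_inj pickleK)[-> ->].
pose P H := square_graph A (G0 `|` H).
have [|H [PH Hmax]] := @Zorn_bigcup _ P.
  move=> F FP Ftot; rewrite /P.
  have [[X0 FX0]|F0] := pselect (exists X, F X); last first.
    suff -> : \bigcup_(X in F) X = set0 by rewrite setU0.
    by rewrite -subset0 => p [X FX _]; case: F0; exists X.
  have -> : G0 `|` \bigcup_(X in F) X = \bigcup_(X in [set G0 `|` X | X in F]) X.
    apply/seteqP; split=> [p [G0p|[X FX Xp]]|p [_ [X FX <-] [G0p|Xp]]].
    - by exists (G0 `|` X0); [exists X0|left].
    - by exists (G0 `|` X); [exists X|right].
    - by left.
    - by right; exists X.
  apply: square_graph_bigcup => [_ [X FX <-]|_ _ [X FX <-] [Y FY <-]].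
    exact: FP.
  by have [XY|YX] := Ftot _ _ FX FY; [left|right]; exact: setUS.
set G := G0 `|` H in PH *; set Y := graph_dom G.
have YA : Y `<=` A by move=> a [b [c Gc]]; have [s1 _ _ _] := PH; have [] := s1 _ _ _ Gc.
have tY i : Y (t i) by have [b [c G0c]] := domG0 i; exists b, c; left.
have [f [fY finj] _] := square_graph_pairing PH.
have [small|large] := card_le_total (A `\` Y) Y.
  apply: (@pairing_transport _ A Y f) => //; last by exists (t 0).
  have [k [kY kinj]] := card_le_inj_on (ex_intro _ (t 0) (tY 0)) small.
  have {}kY a : A a -> ~ Y a -> Y (k a) by move=> Aa Ya; exact: kY.
  have {}kinj a b : A a -> ~ Y a -> A b -> ~ Y b -> k a = k b -> a = b.
    by move=> Aa Ya Ab Yb; exact: kinj.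
  (* Y and its complement are separated by the tags t 0 and t 1 *)
  pose g a := if pselect (Y a) then f (t 0) a else f (t 1) (k a).
  have t01 : t 0 <> t 1 by move=> /tinj.
  apply: (@inj_on_card_le _ _ _ _ g) => [a Aa|a b Aa Ab]; rewrite /g.
    by case: pselect => Ya; apply: (fY); [exact: tY|by []|exact: tY|exact: kY].
  case: pselect => Ya; case: pselect => Yb E.
  - by have [] := finj _ _ _ _ (tY 0) Ya (tY 0) Yb E.
  - by have [/t01] := finj _ _ _ _ (tY 0) Ya (tY 1) (kY _ Ab Yb) E.
  - by have [/esym/t01] := finj _ _ _ _ (tY 1) (kY _ Aa Ya) (tY 0) Yb E.
  - have [_] := finj _ _ _ _ (tY 1) (kY _ Aa Ya) (tY 1) (kY _ Ab Yb) E.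
    exact: kinj.
exfalso; have AY0 : (A `\` Y) !=set0.
  apply/set0P/eqP => AY0; have := Ainf; apply.
  apply: contrapT => _; move: large; rewrite AY0 => /card_le0P Y0.
  by have := tY 0; rewrite Y0.
have [h [hA hinj]] := card_le_inj_on AY0 large.
have [H' sGH' H'G] := @square_graph_extend _ A G h t PH tY tinj hA hinj.
apply: (Hmax (H `|` H')); last by rewrite /P setUA.
split; first by left.
by move=> H'H; apply: H'G => p H'p; right; apply: H'H; right.
Qed.

Lemma card_prod_le T U V (A : set T) (B : set U) (C : set V) :
  infinite_set C -> A #<= C -> B #<= C -> A `*` B #<= C.
Proof.
move=> Cinf AC BC; have C0 := infinite_setN0 Cinf.
have [f [fC finj]] := infinite_pairing Cinf.
have [i [iC iinj]] := card_le_inj_on C0 AC.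
have [j [jC jinj]] := card_le_inj_on C0 BC.
apply: (@inj_on_card_le _ _ _ _ (fun p => f (i p.1) (j p.2))).
  by move=> [a b] [/= Aa Bb]; apply: (fC); [exact: iC|exact: jC].
move=> [a b] [c d] [/= Aa Bb] [/= Ac Bd] /finj[]; try exact: iC; try exact: jC.
by move=> /iinj -> // /jinj ->.
Qed.

Lemma card_seq_le T V (A : set T) (C : set V) : infinite_set C -> A #<= C ->
  [set s : seq T | all (fun x => `[< A x >]) s] #<= C.
Proof.
move=> Cinf AC; have C0 := infinite_setN0 Cinf.
have [f [fC finj]] := infinite_pairing Cinf.
have [i [iC iinj]] := card_le_inj_on C0 AC.
have [t [tC tinj]] := card_le_inj_on C0 ((infiniteP C).1 Cinf).
pose e := foldr (fun x c => f (i x) c) (t 0).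
have eC s : all (fun x => `[< A x >]) s -> C (e s).
  elim: s => [_|x s IH /= /andP[/asboolP Ax sA]]; first exact: tC.
  by apply: (fC); [exact: iC|exact: IH].
have einj s s' : all (fun x => `[< A x >]) s -> all (fun x => `[< A x >]) s' ->
    size s = size s' -> e s = e s' -> s = s'.
  elim: s s' => [|x s IH] [|x' s'] //= /andP[/asboolP Ax sA] /andP[/asboolP Ax' s'A].
  move=> [ss] /finj[||||/iinj-> // /IH-> //]; try exact: iC; exact: eC.
apply: (@inj_on_card_le _ _ _ _ (fun s => f (t (size s)) (e s))) => [s sA|s s' sA s'A].
  by apply: (fC); [exact: tC|exact: eC].
move=> /finj[||||/tinj ss es]; try exact: tC; try exact: eC.
by apply: einj => //; exact: ss.
Qed.

Implicit Types x y z h : cantor_space.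

(** * Strings and the Cantor space *)

Lemma eq_mkseqP (T : Type) (f g : nat -> T) n :
  mkseq f n = mkseq g n <-> forall i, (i < n)%N -> f i = g i.
Proof.
split=> [E i ni|E].
  by have := congr1 (fun s => nth (f i) s i) E; rewrite !nth_mkseq.
apply: (@eq_from_nth _ (f 0%N)); rewrite !size_mkseq // => i ni.
by rewrite !nth_mkseq ?E.
Qed.

Lemma prefix_ofP x y n :
  prefix_of x n = prefix_of y n <-> forall i, (i < n)%N -> x i = y i.
Proof. exact: eq_mkseqP. Qed.

Lemma size_prefix_of x n : size (prefix_of x n) = n.
Proof. exact: size_mkseq. Qed.

Lemma prefix_ofW x y m n : (m <= n)%N ->
  prefix_of x n = prefix_of y n -> prefix_of x m = prefix_of y m.
Proof. by move=> mn /prefix_ofP E; apply/prefix_ofP => i im; apply: E; lia. Qed.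

Lemma take_prefix_of x m n : (m <= n)%N ->
  take m (prefix_of x n) = prefix_of x m.
Proof.
move=> mn; rewrite /prefix_of /mkseq -map_take take_iota.
by rewrite (minn_idPl mn).
Qed.

Lemma cylinderP s x : cylinder s x <-> forall i, (i < size s)%N -> x i = nth false s i.
Proof.
rewrite /cylinder/= -{2}(mkseq_nth false s); exact: eq_mkseqP.
Qed.

Lemma cylinder_cat s t x : cylinder (s ++ t) x -> cylinder s x.
Proof.
move=> /cylinderP E; apply/cylinderP => i si.
by rewrite E ?nth_cat ?si // size_cat; lia.
Qed.

Lemma cylinder_rcons s x : cylinder s x ->
  cylinder (rcons s (x (size s))) x.
Proof.
move=> /cylinderP E; apply/cylinderP => i; rewrite size_rcons nth_rcons ltnS.
by rewrite leq_eqVlt => /predU1P[->|si]; rewrite ?ltnn ?eqxx // si E.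
Qed.

Lemma nbhs_prefix_of x n : nbhs x [set y | prefix_of y n = prefix_of x n].
Proof.
have nx i : nbhs x [set y : cantor_space | y i = x i].
  apply: open_nbhs_nbhs; split => //.
  suff : @open cantor_space (proj i @^-1` [set x i]) by [].
  by apply: open_comp; [move=> + _; exact: proj_continuous|exact: discrete_open].
elim: n => [|n IH]; first exact: filterS filterT.
apply: filterS2 IH (nx n) => y /prefix_ofP E /= yn; apply/prefix_ofP => i.
by rewrite ltnS leq_eqVlt => /predU1P[->//|]; exact: E.
Qed.

(** The filter generated by the cylinders of x converges to x coordinatewise,
    hence in the product topology. *)
Lemma nbhs_cantorE x (U : set cantor_space) : nbhs x U ->
  exists n, forall y, prefix_of y n = prefix_of x n -> U y.
Proof.
pose F : set_system cantor_space := filter_from [set: nat]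
  (fun n => [set y | prefix_of y n = prefix_of x n]).
have FF : Filter F.
  apply: filter_from_filter; first by exists 0%N.
  move=> i j _ _; exists (maxn i j) => // y /= E; split; apply: prefix_ofW E; lia.
suff Fx : F --> x by move=> /Fx [n _ sub]; exists n.
apply/cvg_sup => i V [W [[Q oQ <-] /= Qx] QV].
exists i.+1 => // y /prefix_ofP/(_ i (ltnSn i)) E; apply: QV => /=.
by rewrite E.
Qed.

Lemma closed_prefix_of (P : seq bool -> Prop) n :
  closed [set x | P (prefix_of x n)].
Proof.
move=> x /= /(_ _ (nbhs_prefix_of x n)) [y [/= Py E]].
by rewrite -E.
Qed.

(** Dependent choice in the form used below: strings that can be extended forever
    inside P have a common infinite extension. *)
Lemma string_chain_limit (P : nat -> seq bool -> Prop) :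
  P 0%N [::] ->
  (forall i u, P i u -> exists v, (i < size (u ++ v))%N /\ P i.+1 (u ++ v)) ->
  exists z, forall i, exists2 u, (i <= size u)%N /\ P i u & cylinder u z.
Proof.
move=> P0 Pstep.
have ext (p : nat * seq bool) : exists v, P p.1 p.2 ->
    (p.1 < size (p.2 ++ v))%N /\ P p.1.+1 (p.2 ++ v).
  have [/Pstep[v vP]|nP] := pselect (P p.1 p.2); last by exists [::].
  by exists v.
have [g gP] := choice ext.
pose u := fix u i := if i is j.+1 then u j ++ g (j, u j) else [::].
have uP i : (i <= size (u i))%N /\ P i (u i).
  elim: i => [|i [_ IH]] //=; exact: (gP (i, u i)).
have mono i j t : (i <= j)%N -> (t < size (u i))%N ->
    nth false (u j) t = nth false (u i) t.
  move=> + ti; elim: j => [|j IH]; first by rewrite leqn0 => /eqP->.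
  rewrite leq_eqVlt ltnS => /predU1P[->//|ij]; rewrite /= nth_cat -(IH ij).
  suff -> : (t < size (u j))%N by [].
  apply: leq_trans ti _; elim: j ij {IH} => [|j IH]; first by rewrite leqn0 => /eqP->.
  rewrite leq_eqVlt ltnS => /predU1P[->//|ij] /=.
  by rewrite size_cat (leq_trans (IH ij)) // leq_addr.
exists (fun t => nth false (u t.+1) t) => i; exists (u i) => //.
apply/cylinderP => t ti; have [tS _] := uP t.+1.
by case: (leqP i t.+1) => it; [rewrite (mono i)|rewrite (mono t.+1 i) // ltnW].
Qed.

(** * The coin-tossing outer measure *)

Section CoinMeasure.
Local Open Scope ring_scope.
Variable R : realType.
Implicit Types (A B K : set cantor_space) (c e : R).

(** Covers by cylinders of total weight at most c; stating it with a real bound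
    keeps the extended reals out of the later arguments. *)
Definition covered A c : Prop := exists2 s : nat -> seq bool,
  A `<=` \bigcup_k cylinder (s k)
  & (\sum_(0 <= k <oo) (2^-1 ^+ size (s k))%:E <= c%:E)%E.

Lemma weight_ge0 n : 0 <= 2^-1 ^+ n :> R.
Proof. by rewrite exprn_ge0 // invr_ge0. Qed.

Lemma weight_gt0 n : 0 < 2^-1 ^+ n :> R.
Proof. by rewrite exprn_gt0 // invr_gt0. Qed.

Lemma weight_le1 n : 2^-1 ^+ n <= 1 :> R.
Proof. by rewrite exprn_ile1 // ?invr_ge0 // invf_le1 ?ler1n. Qed.

Lemma weight_small e : 0 < e -> exists n, 2^-1 ^+ n < e.
Proof.
move=> e0; have [n _ nP] := near_infty_natSinv_expn_lt (PosNum e0).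
by exists n; rewrite exprVn -div1r; exact: (nP n (leqnn n)).
Qed.

Lemma coveredW A B c d : A `<=` B -> c <= d -> covered B c -> covered A d.
Proof.
move=> AB cd [s Bs sc]; exists s; first exact: subset_trans AB Bs.
by rewrite (le_trans sc) // lee_fin.
Qed.

Lemma covered_ge0 A c : covered A c -> 0 <= c.
Proof.
move=> [s _]; rewrite -lee_fin; apply: le_trans.
by apply: nneseries_ge0 => k _ _; rewrite lee_fin weight_ge0.
Qed.

Lemma nullP A : null R A <-> forall e, 0 < e -> covered A e.
Proof.
rewrite /null/= /coin_outer; split=> [A0 e e0|cA].
  have : (ereal_inf [set (\sum_(0 <= k <oo) (2^-1 ^+ size (s k))%:E)%E
            | s in [set s : nat -> seq bool |
                    A `<=` \bigcup_k cylinder (s k)]] < e%:E)%E.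
    by rewrite A0 lte_fin.
  by move=> /ereal_inf_lt[_ [s sA <-] /ltW se]; exists s.
apply/eqP; rewrite eq_le; apply/andP; split; last first.
  apply: le_ereal_inf_tmp => _ [s _ <-].
  by apply: nneseries_ge0 => k _ _; rewrite lee_fin weight_ge0.
apply/lee_addgt0Pr => e e0; rewrite add0e; have [s sA se] := cA _ e0.
by apply: le_trans se; apply: ereal_inf_lbound; exists s.
Qed.

Lemma nneseries_pair (a : nat -> nat -> \bar R) (g : nat -> nat * nat) :
  bijective g -> (forall i j, 0 <= a i j)%E ->
  (\sum_(0 <= k <oo) a (g k).1 (g k).2 =
   \sum_(0 <= i <oo) \sum_(0 <= j <oo) a i j)%E.
Proof.
move=> gbij a0; rewrite nneseries_esumT//.
have -> : (\sum_(0 <= i <oo) \sum_(0 <= j <oo) a i j =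
    \esum_(i in [set: nat]) \esum_(j in [set: nat]) a i j)%E.
  rewrite nneseries_esumT; last by move=> n; exact: nneseries_ge0.
  by apply: eq_esum => i _; rewrite nneseries_esumT.
rewrite esum_esum //.
rewrite (reindex_esum setT _ g) //.
move: gbij => [f gK fK]; split=> //= [i j _ _|[i j] _].
  exact: (can_inj gK).
by exists (f (i, j)).
Qed.

Lemma covered_bigcup (A : nat -> set cantor_space) (c : nat -> R) C :
  (forall n, covered (A n) (c n)) -> (\sum_(0 <= n <oo) (c n)%:E <= C%:E)%E ->
  covered (\bigcup_n A n) C.
Proof.
move=> cA cC.
have /choice[s sP] : forall n, exists s : nat -> seq bool,
    A n `<=` \bigcup_k cylinder (s k) /\
    (\sum_(0 <= k <oo) (2^-1 ^+ size (s k))%:E <= (c n)%:E)%E.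
  by move=> n; have [s s1 s2] := cA n; exists s.
have [g gbij] : exists g : nat -> nat * nat, bijective g.
  have /card_esym/ppcard_eqP[g] := card_nat2.
  by exists g; rewrite -setTT_bijective; exact: bij.
exists (fun k => s (g k).1 (g k).2) => [x [n _ /(proj1 (sP n))[k _ xk]]|].
  by case: gbij => f gK fK; exists (f (n, k)); rewrite ?fK.
rewrite (@nneseries_pair (fun i j => (2^-1 ^+ size (s i j))%:E) g) //.
apply: le_trans cC; apply: lee_nneseries => [i _ _|i _]; last exact: (sP i).2.
by apply: nneseries_ge0 => k _ _; rewrite lee_fin weight_ge0.
Qed.
Lemma nneseries_shift (f : nat -> R) : (forall k, 0 <= f k) ->
  (\sum_(0 <= k <oo) (f k)%:E = (f 0%N)%:E + \sum_(0 <= k <oo) (f k.+1)%:E)%E.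
Proof.
move=> f0; have f0E k : (0 <= (f k)%:E)%E by rewrite lee_fin.
have -> : (\sum_(0 <= k <oo) (f k.+1)%:E = \sum_(1 <= k <oo) (f k)%:E)%E.
  by rewrite -(@nneseries_addn _ _ 1) //; apply: eq_eseriesr => i _; rewrite addn1.
by rewrite nneseries_recl.
Qed.

Lemma covered_set0 e : 0 < e -> covered set0 e.
Proof.
move=> e0; have [N Ne] := weight_small e0.
exists (fun k => nseq (N + k.+1) false) => //.
apply: (@le_trans _ _ (2^-1 ^+ N)%:E); last by rewrite lee_fin ltW.
apply: le_trans (epsilon_trick0 xpredT (weight_ge0 N)).
apply: lee_nneseries => [k _ _|k _]; first by rewrite lee_fin weight_ge0.
by rewrite lee_fin size_nseq exprD [in X in _ * X]exprVn natrX.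
Qed.

Lemma covered_cylinderU s A c : covered A c ->
  covered (cylinder s `|` A) (2^-1 ^+ size s + c).
Proof.
move=> [t tA tc]; exists (fun k => if k is j.+1 then t j else s).
  move=> x [sx|/tA[k _ xk]]; first by exists 0%N.
  by exists k.+1.
rewrite (@nneseries_shift (fun k => 2^-1 ^+ size (if k is j.+1 then t j else s))).
  by rewrite EFinD leeD.
by move=> k; exact: weight_ge0.
Qed.

Lemma covered_cylinder s e : 0 < e -> covered (cylinder s) (2^-1 ^+ size s + e).
Proof.
move=> /covered_set0/(covered_cylinderU s); apply: coveredW => //.
Qed.

Lemma covered_setU A B a b e : 0 < e -> covered A a -> covered B b ->
  covered (A `|` B) (a + b + e).
Proof.
move=> e0 cA cB.
pose F n := if n is m.+1 then if m is p.+1 then set0 else B else A.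
pose c n := if n is m.+1 then if m is p.+1 then e / (2 ^ p.+1)%:R else b else a.
have cge0 p : 0 < e / (2 ^ p.+1)%:R :> R.
  by rewrite divr_gt0 // ltr0n expn_gt0.
have -> : A `|` B = \bigcup_n F n.
  apply/seteqP; split=> [x [Ax|Bx]|x [[|[|n]] _ //]].
  - by exists 0%N.
  - by exists 1%N.
  - by left.
  - by right.
apply: (@covered_bigcup F c) => [[|[|n]]|] //; first exact: covered_set0 (cge0 n).
have a0 := covered_ge0 cA; have b0 := covered_ge0 cB.
rewrite nneseries_shift; last by move=> [|[|k]] //=; exact: ltW.
rewrite (@nneseries_shift (fun k => c k.+1)); last by move=> [|k] //=; exact: ltW.
by rewrite /= addeA EFinD leeD // epsilon_trick0 // ltW.
Qed.

Definition outer A : R := inf [set c | covered A c].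

Lemma covered_setT2 A : covered A 2.
Proof.
apply: (@coveredW _ (cylinder [::]) _ (2^-1 ^+ 0 + 1)); last exact: covered_cylinder.
  by move=> x _; apply/cylinderP.
by rewrite expr0.
Qed.

Lemma outer_has_lbound A : has_lbound [set c | covered A c].
Proof. by exists 0 => c; exact: covered_ge0. Qed.

Lemma outer_le A c : covered A c -> outer A <= c.
Proof. by move=> cA; apply: ge_inf => //; exact: outer_has_lbound. Qed.

Lemma outer_lt A c : outer A < c -> covered A c.
Proof.
move=> /inf_lt[|d dA /ltW dc]; first by exists 2; exact: covered_setT2.
exact: coveredW dA.
Qed.

Lemma outer_ge0 A : 0 <= outer A.
Proof.
apply: lb_le_inf; first by exists 2; exact: covered_setT2.
by move=> c; exact: covered_ge0.
Qed.

Lemma le_outer A B : A `<=` B -> outer A <= outer B.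
Proof.
move=> AB; apply: lb_le_inf; first by exists 2; exact: covered_setT2.
by move=> c /(coveredW AB (lexx c))/outer_le.
Qed.

Lemma outer_set0 : outer set0 = 0.
Proof.
apply/eqP; rewrite eq_le outer_ge0 andbT; apply/ler_addgt0Pr => e e0.
by rewrite add0r; apply: outer_le; exact: covered_set0.
Qed.

Lemma outer_setU A B : outer (A `|` B) <= outer A + outer B.
Proof.
apply/ler_addgt0Pr => e e0; pose d := e / 3.
have d0 : 0 < d by rewrite divr_gt0.
have cA : covered A (outer A + d) by apply: outer_lt; rewrite ltrDl.
have cB : covered B (outer B + d) by apply: outer_lt; rewrite ltrDl.
apply: le_trans (outer_le (covered_setU d0 cA cB)) _.
by rewrite /d; lra.
Qed.

Lemma outer_cylinder s : outer (cylinder s) <= 2^-1 ^+ size s.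
Proof. by apply/ler_addgt0Pr => e /(covered_cylinder s)/outer_le. Qed.

Lemma null_outer A : null R A <-> outer A = 0.
Proof.
rewrite nullP; split=> [cA|A0 e e0]; last by apply: outer_lt; rewrite A0.
apply/eqP; rewrite eq_le outer_ge0 andbT; apply/ler_addgt0Pr => e e0.
by rewrite add0r; apply: outer_le; exact: cA.
Qed.

(** The conditional probability of the cylinder of s given that of u. *)
Definition share (u s : seq bool) : R :=
  if prefix u s then 2 ^+ size u * 2^-1 ^+ size s else (prefix s u)%:R.

Lemma share_ge0 u s : 0 <= share u s.
Proof.
by rewrite /share; case: ifP => // _; rewrite mulr_ge0 ?weight_ge0 ?exprn_ge0.
Qed.

Lemma share_self u : share u u = 1.
Proof. by rewrite /share prefix_refl -exprMn mulfV // expr1n. Qed.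

Lemma share_split u s :
  share (rcons u false) s + share (rcons u true) s = 2 * share u s.
Proof.
have [/prefixP[[|b t] ->]|us] := boolP (prefix u s).
- rewrite cats0 share_self /share !prefix_rcons.
  have nr b : prefix (rcons u b) u = false.
    by apply/negP => /size_prefix; rewrite size_rcons ltnn.
  by rewrite !nr mulr1.
- have nr (c : bool) : b != c -> share (rcons u c) (u ++ b :: t) = 0.
    move=> bc; rewrite /share -cats1 !prefix_catr // !eqxx !prefix_cons.
    by rewrite (eq_sym c) (negPf bc).
  have yr : share (rcons u b) (u ++ b :: t) = 2 * share u (u ++ b :: t).
    rewrite /share prefix_prefix -cats1 prefix_catr // eqxx prefix_cons eqxx.
    by rewrite prefix0s size_cat addn1 exprS mulrA.
  by case: b nr yr => nr yr; rewrite yr nr ?addr0 ?add0r.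
- rewrite /share (negPf us).
  have nr b : prefix (rcons u b) s = false.
    by apply: contraNF us; apply: prefix_trans; exact: prefix_rcons.
  have E b : prefix s (rcons u b) = prefix s u.
    apply/idP/idP => [|/prefix_trans->//]; last exact: prefix_rcons.
    move=> /prefixP[t]; case/lastP: t => [|t c].
      by rewrite cats0 => E; move: us; rewrite -E prefix_rcons.
    by rewrite -rcons_cat => /rcons_inj[-> _]; exact: prefix_prefix.
  by rewrite !nr !E mulr_natl mulr2n.
Qed.

(** If cylinders of total weight less than 1 covered the space, then, [share] being
    an average over the two successors of a node, one could descend from the root
    along nodes where the total share stays below 1.  The branch obtained avoids
    every cylinder of the cover, since the share of s in itself is 1. *)
Lemma outer_setT : 1 <= outer setT.
Proof.
rewrite leNgt; apply/negP => mo1; pose d := (outer setT + 1) / 2.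
have [s sT sd] : covered setT d by apply: outer_lt; rewrite /d; lra.
have d1 : d < 1 by rewrite /d; lra.
pose W u : \bar R := (\sum_(0 <= k <oo) (share u (s k))%:E)%E.
have W0 u k : (0 <= (share u (s k))%:E)%E by rewrite lee_fin share_ge0.
have [||z zP] := @string_chain_limit (fun i u => size u = i /\ (W u < 1%:E)%E).
- split=> //; apply: le_lt_trans (_ : (d%:E < 1%:E)%E); last by rewrite lte_fin.
  apply: le_trans sd; apply: lee_nneseries => // k _.
  by rewrite /share prefix0s expr0 mul1r.
- move=> i u [ui Wu].
  suff [b Wb] : exists b, (W (rcons u b) < 1%:E)%E.
    by exists [:: b]; rewrite cats1 size_rcons ui.
  apply: contrapT => nW; have W1 b : (1%:E <= W (rcons u b))%E.
    by rewrite leNgt; apply/negP => Wb; apply: nW; exists b.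
  have : (W (rcons u false) + W (rcons u true) = 2%:E * W u)%E.
    rewrite -nneseriesD // -nneseriesZl //; apply: eq_eseriesr => k _.
    by rewrite -EFinD share_split EFinM.
  have := leeD (W1 false) (W1 true) => /[swap] ->.
  have Wfin : W u \is a fin_num.
    by rewrite ge0_fin_numE ?(lt_trans Wu) ?ltry // nneseries_ge0.
  move: Wu; rewrite -(fineK Wfin) -EFinD -EFinM lte_fin lee_fin; lra.
- have [k _ zk] := sT z I; have [u [_ [us Wu]] uz] := zP (size (s k)).
  have E : u = s k by rewrite -[LHS](uz : _ = u) us; exact: zk.
  have := @nneseries_lim_ge _ (fun k => (share u (s k))%:E) xpredT 0%N k.+1.
  move=> /(_ (fun n _ _ => W0 u n)) /le_lt_trans/(_ Wu).
  rewrite big_nat_recr //= {2}E share_self sumEFin -EFinD lte_fin.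
  suff : 0 <= \sum_(0 <= i < k) share u (s i) by lra.
  by apply: sumr_ge0 => i _; exact: share_ge0.
Qed.

Lemma outer_setT_gt0 K U : U `|` K = setT -> outer U < 1 -> 0 < outer K.
Proof.
move=> UK U1; have := le_trans outer_setT (_ : outer setT <= outer U + outer K).
by rewrite -UK => /(_ (outer_setU _ _)); lra.
Qed.

(** The relative outer measure of K inside the cylinder of u. *)
Definition density K u : R := 2 ^+ size u * outer (cylinder u `&` K).

(** The submartingale inequality, which is all that is kept of an outer measure in
    the combinatorial estimates. *)
Definition subaveraging (o : seq bool -> R) : Prop :=
  forall u, o u <= (o (rcons u false) + o (rcons u true)) / 2.

Lemma density_le1 K u : density K u <= 1.
Proof.
have -> : 1 = 2 ^+ size u * 2^-1 ^+ size u :> R.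
  by rewrite -exprMn mulfV // expr1n.
rewrite ler_pM2l ?exprn_gt0 //; apply: le_trans (outer_cylinder u).
by apply: le_outer; exact: subIsetl.
Qed.

Lemma density0 K u : cylinder u `&` K = set0 -> density K u = 0.
Proof. by rewrite /density => ->; rewrite outer_set0 mulr0. Qed.

Lemma density_nil K : density K [::] = outer K.
Proof.
rewrite /density mul1r; congr outer; apply/seteqP; split=> [x []//|x Kx].
by split=> //; exact/cylinderP.
Qed.

Lemma density_subaveraging K : subaveraging (density K).
Proof.
move=> u; rewrite /density !size_rcons exprS.
set w := 2 ^+ size u; set p := outer _; set q := outer _; set r := outer _.
suff pqr : p <= q + r.
  have -> : (2 * w * q + 2 * w * r) / 2 = w * (q + r) by lra.
  by rewrite ler_pM2l // exprn_gt0.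
apply: le_trans (outer_setU _ _); apply: le_outer => x [ux Kx].
by have := cylinder_rcons ux; case: (x (size u)) => ?; [right|left].
Qed.

Section Subaveraging.
Variable o : seq bool -> R.
Hypothesis avg : subaveraging o.

Lemma subaveraging_le a s c : (forall u, size u = a -> o (s ++ u) <= c) ->
  o s <= c.
Proof.
elim: a s => [|a IH] s oc; first by rewrite -(cats0 s); exact: oc.
have oc' b : o (rcons s b) <= c.
  by apply: IH => u ua; rewrite cat_rcons; apply: oc; rewrite /= ua.
by have := avg s; have := oc' false; have := oc' true; lra.
Qed.

(** If o vanishes on one of the 2^a extensions by a bits and is at most c on the
    others, its average is at most (1 - 2^-a) c. *)
Lemma subaveraging_avoid0 a s c :
  (forall u, size u = a -> o (s ++ u) <= c) -> o (s ++ nseq a false) <= 0 ->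
  o s <= (1 - 2^-1 ^+ a) * c.
Proof.
elim: a s => [|a IH] s oc o0; first by rewrite expr0 subrr mul0r -(cats0 s).
have of0 : o (rcons s false) <= (1 - 2^-1 ^+ a) * c.
  apply: IH => [u ua|]; last by rewrite cat_rcons.
  by rewrite cat_rcons; apply: oc; rewrite /= ua.
have ot : o (rcons s true) <= c.
  apply: (@subaveraging_le a) => u ua.
  by rewrite cat_rcons; apply: oc; rewrite /= ua.
have -> : (1 - 2^-1 ^+ a.+1) * c = ((1 - 2^-1 ^+ a) * c + c) / 2.
  by rewrite exprS; set w := 2^-1 ^+ a; lra.
by have := avg s; lra.
Qed.

Lemma subaveraging_only0 a s c :
  (forall u, size u = a -> u != nseq a false -> o (s ++ u) <= 0) ->
  o (s ++ nseq a false) <= c -> o s <= 2^-1 ^+ a * c.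
Proof.
elim: a s => [|a IH] s o0 oc; first by rewrite expr0 mul1r -(cats0 s).
have of0 : o (rcons s false) <= 2^-1 ^+ a * c.
  apply: IH => [u ua u0|]; last by rewrite cat_rcons.
  by rewrite cat_rcons; apply: o0; rewrite /= ?ua.
have ot : o (rcons s true) <= 0.
  apply: (@subaveraging_le a) => u ua.
  by rewrite cat_rcons; apply: o0; rewrite /= ?ua.
have -> : 2^-1 ^+ a.+1 * c = (2^-1 ^+ a * c) / 2.
  by rewrite exprS -mulrA mulrC.
by have := avg s; lra.
Qed.

End Subaveraging.
End CoinMeasure.

(** * Interval partitions and finite strings *)

(** For the partition of omega into the intervals [e i, e (i+1)), this is the index
    of the interval that contains p; equally, the number of intervals that end
    by p. *)
Definition block_index (e : nat -> nat) (p : nat) : nat :=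
  count (fun i => (e i.+1 <= p)%N) (iota 0 p).

Lemma block_start_mono (e : nat -> nat) i j : (forall i, (e i < e i.+1)%N) ->
  (i <= j)%N -> (e i <= e j)%N.
Proof.
move=> emono; elim: j => [|j IH]; first by rewrite leqn0 => /eqP->.
rewrite leq_eqVlt ltnS => /predU1P[->//|/IH/leq_trans]; apply.
exact: ltnW.
Qed.

Lemma block_start_ge (e : nat -> nat) i : (forall i, (e i < e i.+1)%N) ->
  (i <= e i)%N.
Proof. by move=> emono; elim: i => // i IH; exact: leq_ltn_trans IH _. Qed.

Lemma block_indexE (e : nat -> nat) i p : (forall i, (e i < e i.+1)%N) ->
  (e i <= p < e i.+1)%N -> block_index e p = i.
Proof.
move=> emono /andP[ip pi].
have lip : (i <= p)%N by apply: leq_trans (block_start_ge _ emono) ip.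
rewrite /block_index -(subnKC lip) iotaD count_cat add0n.
rewrite (_ : count _ (iota 0 i) = i); last first.
  rewrite (eq_in_count (a2 := predT)) ?count_predT ?size_iota // => j.
  rewrite mem_iota add0n subnKC // => /andP[_ ji].
  by rewrite (leq_trans (block_start_mono emono ji) ip).
rewrite (eq_in_count (a2 := pred0)) ?count_pred0 ?addn0 // => j.
rewrite mem_iota subnKC // => /andP[ij _] /=; apply/negbTE; rewrite -ltnNge.
by apply: leq_trans pi _; apply: block_start_mono.
Qed.

Lemma block_index_mono e p q : (p <= q)%N -> (block_index e p <= block_index e q)%N.
Proof.
move=> pq; rewrite /block_index -{2}(subnKC pq) iotaD count_cat.
apply: leq_trans (leq_addr _ _); apply: sub_count => i /= ip.
exact: leq_trans ip pq.
Qed.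

(** Binary value, least significant bit first; it numbers the rows of a table by
    the strings of a given length. *)
Definition bval (s : seq bool) : nat := foldr (fun (b : bool) v => (b + v.*2)%N) 0%N s.

Lemma bval_lt s : (bval s < 2 ^ size s)%N.
Proof. by elim: s => //= b s IH; rewrite expnS; case: b => /=; lia. Qed.

Lemma bval_inj s t : size s = size t -> bval s = bval t -> s = t.
Proof.
elim: s t => [|b s IH] [|c t] //= [st] E.
have : b = c by move: E; case: b; case: c => //=; lia.
move: E => /[swap] ->  E; congr (_ :: _); apply: IH => //.
by move: E; case: c => /=; lia.
Qed.

Definition strings (n : nat) : seq (seq bool) := map val (enum {: n.-tuple bool}).

Lemma mem_strings n s : (s \in strings n) = (size s == n).
Proof.
apply/mapP/eqP => [[t _ ->]|sn]; first exact: size_tuple.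
by exists (tcast sn (in_tuple s)); rewrite ?mem_enum //= val_tcast.
Qed.

Lemma uniq_strings n : uniq (strings n).
Proof. by rewrite map_inj_uniq ?enum_uniq //; exact: val_inj. Qed.

(** * A null set that detects null-additivity *)

Section PointerTables.
Local Open Scope ring_scope.
Variables (R : realType) (L : nat -> nat).

(** The n-th block consists of a pointer of L n bits followed by a table of 2^(L n)
    rows of n bits; the spare bit makes every block nonempty. *)
Fixpoint start n : nat :=
  if n is m.+1 then (start m + (L m + m * 2 ^ L m).+1)%N else 0%N.

Lemma start_lt i : (start i < start i.+1)%N.
Proof. by rewrite /= addnS ltnS leq_addr. Qed.

Definition table_row (p : seq bool) n (z : nat -> bool) : nat :=
  bval (mkseq (fun t => nth false p t (+) z (start n + t)%N) (L n)).

(** The point z, translated by p on the n-th pointer, points to a row of zeros.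
    Untranslated, this is an event of probability 2^-n.  Its translates by
    distinct p read distinct rows of the same table, hence are independent given
    the pointer: this makes unions of many translates large. *)
Definition hits (p : seq bool) n (z : nat -> bool) : Prop :=
  forall t, (t < n)%N -> z (start n + L n + n * table_row p n z + t)%N = false.

Definition pointer_null : set cantor_space :=
  [set z | forall m, exists2 n, (m <= n)%N & hits [::] n z].

Definition pointer_code (p : nat -> seq bool) : cantor_space :=
  fun i => let n := block_index start i in
    (i < start n + L n)%N && nth false (p n) (i - start n).

Lemma table_row_lt p n z : (table_row p n z < 2 ^ L n)%N.
Proof. by apply: leq_trans (bval_lt _) _; rewrite size_mkseq. Qed.

Lemma table_row_ext p q n z w :
  (forall t, (t < L n)%N ->
     nth false p t (+) z (start n + t)%N = nth false q t (+) w (start n + t)%N) ->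
  table_row p n z = table_row q n w.
Proof. by move=> E; rewrite /table_row; congr bval; apply/eq_mkseqP. Qed.

Lemma table_row_inj p q n z : size p = L n -> size q = L n ->
  table_row p n z = table_row q n z -> p = q.
Proof.
move=> sp sq /bval_inj; rewrite !size_mkseq => /(_ erefl)/eq_mkseqP E.
apply: (@eq_from_nth _ false); first by rewrite sp.
by move=> t; rewrite sp => /E/addIb.
Qed.

(** A coded point vanishes on the tables, so adding it only moves the pointers. *)
Lemma hits_pointer_code (p : nat -> seq bool) n z :
  hits [::] n (cantor_add (pointer_code p) z) <-> hits (p n) n z.
Proof.
have bi t : (t < (L n + n * 2 ^ L n).+1)%N -> block_index start (start n + t) = n.
  by move=> tn; apply: (block_indexE start_lt); rewrite /=; lia.
have rE : table_row [::] n (cantor_add (pointer_code p) z) = table_row (p n) n z.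
  apply: table_row_ext => t tL; rewrite nth_nil /cantor_add /pointer_code /=.
  by rewrite bi ?ltn_add2l ?tL ?addKn //; lia.
have zE t : (t < n)%N ->
    cantor_add (pointer_code p) z (start n + L n + n * table_row (p n) n z + t)%N =
    z (start n + L n + n * table_row (p n) n z + t)%N.
  move=> tn; rewrite /cantor_add /pointer_code -!addnA bi; last first.
    have := table_row_lt (p n) n z; set r := table_row _ _ _; set w := (2 ^ L n)%N => rw.
    have : (n * r.+1 <= n * w)%N by rewrite leq_mul2l rw orbT.
    by rewrite mulnS; lia.
  by rewrite ltn_add2l ltnNge leq_addr.
by rewrite /hits rE; split=> H t tn; have := H t tn; rewrite zE.
Qed.

(** Read the table row by row, after the pointer.  Each p in S turns one row into a
    row where a zero value makes o vanish, and distinct p concern distinct rows;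
    every such row costs a factor 1 - 2^-n. *)
Lemma block_bound (o : seq bool -> R) n s (S : seq (seq bool)) c :
  subaveraging o -> size s = start n -> uniq S ->
  (forall p, p \in S -> size p = L n) ->
  (forall p u, p \in S -> (forall z, cylinder (s ++ u) z -> hits p n z) ->
     o (s ++ u) <= 0) ->
  (forall u, size (s ++ u) = start n.+1 -> o (s ++ u) <= c) ->
  o s <= (1 - 2^-1 ^+ n) ^+ size S * c.
Proof.
move=> avg sn Suniq SL o0 oc.
apply: (subaveraging_le avg (a := L n)) => q qL.
pose f p := table_row p n (nth false (s ++ q)).
have fE p v z : cylinder (s ++ q ++ v) z -> table_row p n z = f p.
  rewrite catA => /cylinder_cat/cylinderP E; apply: table_row_ext => t tL.
  by rewrite E // size_cat sn qL ltn_add2l.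
suff claim : forall k r v, (r + k = 2 ^ L n)%N -> size v = (n * r)%N ->
    o (s ++ q ++ v) <= (1 - 2^-1 ^+ n) ^+ count (fun p => (r <= f p)%N) S * c.
  have := claim (2 ^ L n)%N 0%N [::]; rewrite add0n muln0 cats0 => /(_ erefl erefl).
  by rewrite (eq_count (a2 := predT)) // count_predT.
elim=> [|k IH] r v rk vr.
  rewrite addn0 in rk.
  rewrite (eq_in_count (a2 := pred0)) ?count_pred0 ?expr0 ?mul1r; last first.
    by move=> p _ /=; apply/negbTE; rewrite -ltnNge rk; exact: table_row_lt.
  apply: (subaveraging_le avg (a := 1%N)) => u u1.
  by rewrite -!catA; apply: oc; rewrite !size_cat sn qL vr rk u1 /=; lia.
have IHr u : size u = n -> o ((s ++ q ++ v) ++ u) <=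
    (1 - 2^-1 ^+ n) ^+ count (fun p => (r.+1 <= f p)%N) S * c.
  move=> un; rewrite -!catA; apply: IH; first by rewrite addSn -addnS.
  by rewrite size_cat vr un mulnS addnC.
have cE : count (fun p => (r <= f p)%N) S =
    (count (fun p => f p == r) S + count (fun p => (r.+1 <= f p)%N) S)%N.
  elim: (S) => //= p S' ->; rewrite (leq_eqVlt r) (eq_sym r).
  by case: eqP => [->|_] /=; rewrite ?ltnn; lia.
have [/hasP[p pS /eqP fp]|] := boolP (has (fun p => f p == r) S).
  have -> : count (fun p => (r <= f p)%N) S =
      (count (fun p => (r.+1 <= f p)%N) S).+1.
    rewrite cE -[RHS]add1n; congr addn.
    rewrite (eq_in_count (a2 := pred1 p)) => [|p' p'S /=].
      by rewrite -/(count_mem _ _) count_uniq_mem // pS.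
    apply/eqP/eqP => [fp'|->//].
    apply: (@table_row_inj _ _ n (nth false (s ++ q))); rewrite ?SL //.
    by move: fp' fp; rewrite /f => -> ->.
  rewrite exprS -mulrA; apply: (subaveraging_avoid0 avg) => //.
  rewrite -!catA; apply: (o0 p) => // z zu t tn.
  rewrite (fE _ _ _ zu) fp; move/cylinderP : zu => ->.
    rewrite !nth_cat sn qL vr nth_nseq.
    do !case: ifP => //; try lia.
  by rewrite !size_cat sn qL vr size_nseq; lia.
move=> nh; rewrite cE (_ : count _ S = 0%N) ?add0n.
  exact: (subaveraging_le avg (a := n)).
by apply/eqP; rewrite -leqn0 leqNgt -has_count.
Qed.
End PointerTables.

(** * Null-additive sets are localized *)

Section Localization.
Local Open Scope ring_scope.
Variables (R : realType) (L : nat -> nat).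
Local Notation start := (start L).
Local Notation hits := (hits L).

Lemma outer_hits n : outer R [set z | hits [::] n z] <= 2^-1 ^+ n.
Proof.
set G := [set z | _]; rewrite -density_nil; have avg := @density_subaveraging R G.
apply: (subaveraging_le avg (a := (start n + L n)%N)) => s sE /=.
pose r := table_row L [::] n (nth false s).
apply: (subaveraging_le avg (a := (n * r)%N)) => u uE.
rewrite -[X in _ <= X]mulr1; apply: (subaveraging_only0 avg); last exact: density_le1.
move=> v vn v0; rewrite density0 // -subset0 => z [zu Gz].
move/eqP: v0; apply; apply: (@eq_from_nth _ false); first by rewrite vn size_nseq.
move=> t; rewrite vn => tn; rewrite nth_nseq tn.
have rE : table_row L [::] n z = r.
  apply: table_row_ext => i iL; rewrite !nth_nil /=; move/cylinderP : zu => ->.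
    by rewrite -catA nth_cat sE ltn_add2l iL.
  by rewrite !size_cat sE; lia.
have := Gz t tn; rewrite rE; move/cylinderP : zu => -> => [E|].
  rewrite -[RHS]E -catA !nth_cat sE uE; do !case: ifP => //; try lia.
  by move=> _ _; congr nth; lia.
by rewrite !size_cat sE uE vn; lia.
Qed.

Lemma null_pointer_null : null R (pointer_null L).
Proof.
apply/nullP => e e0; have [m me] := @weight_small R (e / 4) (divr_gt0 e0 (ltr0Sn _ 3)).
apply: (@coveredW R _ (\bigcup_n [set z | hits [::] (m + n)%N z]) _ e) => //.
  move=> z /(_ m)[n mn zn]; exists (n - m)%N => //=.
  by rewrite subnKC.
(* 2 ^ -(m + n) doubled, as covers only reach the outer measure in the limit *)
apply: (@covered_bigcup R _ (fun n => 4 * 2^-1 ^+ m / (2 ^ n.+1)%:R)).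
  move=> n; apply: outer_lt; apply: le_lt_trans (outer_hits _) _.
  rewrite natrX exprS invfM -exprVn exprD.
  have := weight_gt0 R m; have := weight_gt0 R n.
  set a := 2^-1 ^+ n; set b := 2^-1 ^+ m => a0 b0; nra.
apply: le_trans (epsilon_trick0 xpredT _) _; last by rewrite lee_fin; lra.
by rewrite mulr_ge0 // ltW // weight_gt0.
Qed.

Lemma pow_half n : (1 - 2^-1 ^+ n) ^+ (2 ^ n) <= 2^-1 :> R.
Proof.
set w := 2^-1 ^+ n; set N := (2 ^ n)%N.
have w0 : 0 < w by exact: weight_gt0.
have w1 : w <= 1 by exact: weight_le1.
have Nw : N%:R * w = 1 by rewrite /N /w natrX -exprMn mulfV // expr1n.
(* Bernoulli's inequality gives (1 + w) ^ N >= 2, while (1 - w) (1 + w) <= 1 *)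
have bern k : 1 + k%:R * w <= (1 + w) ^+ k.
  elim: k => [|k IH]; first by rewrite mul0r addr0.
  rewrite exprS; apply: (@le_trans _ _ ((1 + w) * (1 + k%:R * w))).
    have : 0 <= k%:R * (w * w) by rewrite mulr_ge0 // mulr_ge0 ?ltW.
    rewrite -natr1; set a := k%:R; nra.
  by rewrite ler_pM2l //; lra.
have := bern N; rewrite Nw => b2.
have : (1 - w) ^+ N * (1 + w) ^+ N <= 1.
  rewrite -exprMn exprn_ile1 //; nra.
have : 0 <= (1 - w) ^+ N by rewrite exprn_ge0 // subr_ge0.
nra.
Qed.

(** For o the density of K, these are the pointers p such that K has measure zero
    in the part of the cylinder of s where the n-th block translated by p is
    hit. *)
Definition absorbed (o : seq bool -> R) (s : seq bool) n : seq (seq bool) :=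
  [seq p <- strings (L n) | `[< forall u, prefix s u ->
     (forall z, cylinder u z -> hits p n z) -> o u <= 0 >]].

(** Otherwise, at infinitely many n, at least 2^n rows of the n-th table have to be
    nonzero almost everywhere in K, and each such block halves the density of K in
    the cylinder of s. *)
Lemma absorbed_small (o : seq bool -> R) s :
  subaveraging o -> (forall u, o u <= 1) -> 0 < o s ->
  exists m, forall n, (m <= n)%N -> (size (absorbed o s n) < 2 ^ n)%N.
Proof.
move=> avg o1 os; apply: contrapT => large.
have {}large m : exists2 n, (m <= n)%N & (2 ^ n <= size (absorbed o s n))%N.
  apply: contrapT => nl; apply: large; exists m => n mn.
  by rewrite ltnNge; apply/negP => nS; apply: nl; exists n.
have half k n u : (size s <= n)%N -> prefix s u -> size u = start n ->
    o u <= 2^-1 ^+ k.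
  elim: k n u => [|k IH] n u sn su un; first by rewrite expr0.
  have [n' nn' nS] := large n.
  have snn' := block_start_mono (start_lt L) nn'.
  apply: (subaveraging_le avg (a := (start n' - start n)%N)) => v vE.
  have su' : prefix s (u ++ v) by exact: prefix_catl.
  have c0 := weight_ge0 R k.
  apply: (@le_trans _ _ ((1 - 2^-1 ^+ n') ^+ size (absorbed o s n') * 2^-1 ^+ k)).
    apply: (block_bound avg (n := n') (L := L)).
    - by rewrite size_cat un vE subnKC.
    - by rewrite filter_uniq // uniq_strings.
    - by move=> p; rewrite mem_filter mem_strings => /andP[_ /eqP].
    - move=> p w; rewrite mem_filter => /andP[/asboolP pS _] pw.
      by apply: pS => //; exact: prefix_catl.
    - by move=> w wE; apply: (IH n'.+1) => //; [lia|exact: prefix_catl].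
  rewrite exprS ler_wpM2r //; apply: le_trans (pow_half n').
  have w0 := weight_gt0 R n'.
  have w1 := weight_le1 R n'.
  by apply: ler_wiXn2l => //; lra.
have o0 : o s <= 0.
  apply/ler_addgt0Pr => e /weight_small[k ke]; rewrite add0r.
  apply: le_trans (ltW ke); have sn := block_start_ge (size s) (start_lt L).
  apply: (subaveraging_le avg (a := (start (size s) - size s)%N)) => u uE.
  apply: (half _ (size s)) => //; first exact: prefix_prefix.
  by rewrite size_cat uE subnKC.
by rewrite leNgt os in o0.
Qed.

Lemma subaveraging_extend (o : seq bool -> R) u : subaveraging o -> 0 < o u ->
  exists b, 0 < o (rcons u b).
Proof.
move=> avg ou; have := avg u.
have [of0|of0] := ltP 0 (o (rcons u false)); first by exists false.
have [ot0|ot0] := ltP 0 (o (rcons u true)); first by exists true.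
lra.
Qed.

(** A Baire category argument.  If every cylinder where K has positive measure
    could be refined, preserving this, to one inside the n-th event translated by
    p n, for arbitrarily large n, the limit of such refinements would be the sum of
    the coded point and a point of the null set; so it would lie in the cover,
    which is open and misses K. *)
Lemma null_additive_absorbed (W : set cantor_space) (K : set cantor_space)
    (s : nat -> seq bool) (p : nat -> seq bool) :
  [set cantor_add x y | x in W & y in pointer_null L] `<=`
    \bigcup_k cylinder (s k) ->
  (\bigcup_k cylinder (s k)) `&` K = set0 -> 0 < outer R K -> W (pointer_code L p) ->
  exists t m, 0 < density R K t /\ forall n, (m <= n)%N -> forall u, prefix t u ->
     (forall z, cylinder u z -> hits (p n) n z) -> density R K u <= 0.
Proof.
move=> WU UK K0 Wp; apply: contrapT => bad; set o := density R K in bad *.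
have avg : subaveraging o by exact: density_subaveraging.
pose P i u := 0 < o u /\ (i = 0%N \/ exists2 n, (i <= n.+1)%N &
  forall z, cylinder u z -> hits (p n) n z).
have [||z zP] := @string_chain_limit P.
- by split; [rewrite /o density_nil|left].
- move=> i u [ou _].
  have [v [ov vi [n ni vn]]] : exists v, [/\ 0 < o (u ++ v), (i < size (u ++ v))%N
      & exists2 n, (i <= n)%N & forall z, cylinder (u ++ v) z -> hits (p n) n z].
    have [v [ov [n ni vn]]] : exists v, 0 < o (u ++ v) /\
      exists2 n, (i <= n)%N & forall z, cylinder (u ++ v) z -> hits (p n) n z.
      apply: contrapT => nv; apply: bad; exists u, i; split=> // n ni w.
      move=> /prefixP[v ->] vn; rewrite leNgt; apply/negP => ov.
      by apply: nv; exists v; split=> //; exists n.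
    suff [w [ow wi]] : exists w, 0 < o ((u ++ v) ++ w) /\ size w = i.+1.
      exists (v ++ w); rewrite catA; split=> //; first by rewrite size_cat wi; lia.
      by exists n => // z /cylinder_cat; exact: vn.
    elim: i.+1 => [|j [w [ow wj]]]; first by exists [::]; rewrite cats0.
    have [b ob] := subaveraging_extend avg ow.
    by exists (rcons w b); rewrite -rcons_cat size_rcons wj.
  by exists v; split=> //; split=> //; right; exists n.
have Nz : pointer_null L (cantor_add (pointer_code L p) z).
  move=> m; have [u [_ [_ [//|[n mn un]]]] uz] := zP m.+1.
  by exists n => //; apply/hits_pointer_code; exact: un.
have [k _ zk] : (\bigcup_k cylinder (s k)) z.
  apply: WU; exists (pointer_code L p) => //.
  exists (cantor_add (pointer_code L p) z) => //.
  by apply/funext => i; rewrite /cantor_add addKb.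
have [u [us [ou _]] uz] := zP (size (s k)).
move: ou; rewrite /o density0 ?ltxx // -subset0 -UK => x [ux Kx]; split=> //.
exists k => //; apply/cylinderP => i si; move/cylinderP: zk => <- //.
by move/cylinderP: ux => ->; [move/cylinderP: uz => ->|]; rewrite // (leq_trans si us).
Qed.

(** Translating the null set of the tables by the coded points leaves a set K of
    positive measure uncovered.  Each point is absorbed by K inside some cylinder t;
    there are countably many t, and each absorbs fewer than 2^n pointers at almost
    all n.  So it is enough to collect, at stage n, what the first n + 1 cylinders
    absorb. *)
Lemma null_additive_slalom T (X : set T) (p : T -> nat -> seq bool) :
  (forall w n, X w -> size (p w n) = L n) ->
  null_additive R [set pointer_code L (p w) | w in X] ->
  exists S : nat -> seq (seq bool), (forall n, size (S n) <= n.+1 * 2 ^ n)%N /\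
    forall w, X w -> exists m, forall n, (m <= n)%N -> p w n \in S n.
Proof.
have half0 : (0 : R) < 1 / 2 by lra.
move=> pL /(_ _ null_pointer_null)/nullP/(_ _ half0).
move=> [s sU sum]; set U := \bigcup_k cylinder (s k) in sU.
pose K := ~` U; have K0 : 0 < outer R K.
  apply: (@outer_setT_gt0 _ _ U); first by rewrite /K setUv.
  apply: (@le_lt_trans _ _ (1 / 2)); last by lra.
  by apply: outer_le; exists s.
pose T' i n := absorbed (density R K) (odflt [::] (unpickle i)) n.
pose S n := flatten [seq (if (size (T' i n) < 2 ^ n)%N then T' i n else [::]) |
  i <- iota 0 n.+1].
exists S; split=> [n|w Xw].
  suff bound k i : (size (flatten [seq (if (size (T' i n) < 2 ^ n)%N then T' i n
      else [::]) | i <- iota i k]) <= k * 2 ^ n)%N by exact: bound.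
  elim: k i => // k IH i; rewrite [iota _ _]/= [map _ _]/= [flatten _]/=.
  by rewrite size_cat mulSn leq_add //; case: ifP => // /ltnW.
have UK : U `&` K = set0 by rewrite setICr.
have [t [m [ot tm]]] := null_additive_absorbed sU UK K0 (ex_intro2 _ _ w Xw erefl).
have [m' m'P] := absorbed_small (@density_subaveraging R K) (@density_le1 R K) ot.
exists (maxn (maxn m m') (pickle t)) => n; rewrite !geq_max => /andP[/andP[mn m'n] tn].
apply/flattenP; exists (T' (pickle t) n); last first.
  rewrite /T' pickleK /= mem_filter mem_strings pL // eqxx andbT.
  by apply/asboolP => u; exact: tm.
apply/mapP; exists (pickle t); first by rewrite mem_iota.
by rewrite /T' pickleK /= m'P.
Qed.
End Localization.

(** * The ideals of slow level growth *)

Lemma finite_prefixes (A : set cantor_space) n :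
  finite_set [set prefix_of h n | h in A].
Proof.
apply: (@sub_finite_set _ _ [set` strings n]); last exact: finite_seq.
by move=> _ [h _ <-] /=; rewrite mem_strings size_prefix_of.
Qed.

Lemma level_le_size (A : set cantor_space) n (s : seq (seq bool)) :
  (forall h, A h -> prefix_of h n \in s) -> (level A n <= size s)%N.
Proof.
move=> As; rewrite /level; apply: uniq_leq_size; first exact: finmap.fset_uniq.
move=> u; rewrite in_fset_set; last exact: finite_prefixes.
by move=> /set_mem[h Ah <-]; exact: As.
Qed.

Lemma size_le_level (A : set cantor_space) n (s : seq (seq bool)) :
  uniq s -> (forall u, u \in s -> exists2 h, A h & prefix_of h n = u) ->
  (size s <= level A n)%N.
Proof.
move=> us sA; rewrite /level; apply: uniq_leq_size => // u /sA[h Ah <-].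
rewrite in_fset_set; last exact: finite_prefixes.
by apply/mem_set; exists h.
Qed.

Lemma le_level (A B : set cantor_space) n : A `<=` B -> (level A n <= level B n)%N.
Proof.
move=> AB; apply: level_le_size => h Ah.
rewrite in_fset_set; last exact: finite_prefixes.
by apply/mem_set; exists h => //; exact: AB.
Qed.

Lemma level_setU (A B : set cantor_space) n :
  (level (A `|` B) n <= level A n + level B n)%N.
Proof.
rewrite /level -size_cat; apply: level_le_size => h.
by case=> Xh; rewrite mem_cat !in_fset_set; try exact: finite_prefixes;
  apply/orP; [left|right]; apply/mem_set; exists h.
Qed.

Lemma block_index_HH e : (forall i, (e i < e i.+1)%N) -> e 0%N = 0%N ->
  HH (block_index e).
Proof.
move=> emono e0; split=> [p q|k|n].
- exact: block_index_mono.
- by exists (e k.+1); rewrite (@block_indexE _ k.+1) // leqnn emono.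
- by rewrite -[leqRHS](size_iota 0); exact: count_size.
Qed.

Section LevelIdeal.
Variables (R : realType) (f : nat -> nat).

Lemma ideal_ofP (A : set cantor_space) : ideal_of R f A <->
  A `<=` QQ /\ forall k, exists n0, forall n, (n0 <= n)%N -> (k * level A n <= f n)%N.
Proof.
rewrite /ideal_of/=; split=> -[AQ Af]; split=> //.
  case=> [|k]; first by exists 0%N.
  have [n0 _ n0P] := Af k.+1%:R%R (ltr0Sn R k); exists n0 => n n0n.
  have := n0P n n0n => /=.
  by rewrite ler_pdivlMl ?ltr0Sn // -natrM ler_nat.
move=> d d0; have [n0 n0P] := Af (Num.bound d).+1.
exists n0 => // n /n0P nP /=; rewrite ler_pdivlMl //.
apply: (@le_trans _ _ ((Num.bound d).+1 * level A n)%:R%R); last by rewrite ler_nat.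
rewrite natrM ler_wpM2r // ltW // (lt_le_trans (archi_boundP (ltW d0))) //.
by rewrite ler_nat.
Qed.

Lemma ideal_ofW (A B : set cantor_space) : A `<=` B ->
  ideal_of R f B -> ideal_of R f A.
Proof.
move=> AB /ideal_ofP[BQ Bf]; apply/ideal_ofP; split; first exact: subset_trans BQ.
move=> k; have [n0 n0P] := Bf k; exists n0 => n /n0P; apply: leq_trans.
by rewrite leq_mul2l le_level ?orbT.
Qed.

Lemma ideal_of_setU (A B : set cantor_space) :
  ideal_of R f A -> ideal_of R f B -> ideal_of R f (A `|` B).
Proof.
move=> /ideal_ofP[AQ Af] /ideal_ofP[BQ Bf]; apply/ideal_ofP; split.
  by rewrite subUset.
move=> k; have [a aP] := Af (k * 2)%N; have [b bP] := Bf (k * 2)%N.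
exists (maxn a b) => n; rewrite geq_max => /andP[/aP ? /bP ?].
have := level_setU A B n; nia.
Qed.

Hypothesis Hf : HH f.

Lemma HH_unbounded m : exists n0, forall n, (n0 <= n)%N -> (m <= f n)%N.
Proof.
have [mono unb _] := Hf; have [n0 mn0] := unb m; exists n0 => n n0n.
exact: leq_trans (ltnW mn0) (mono _ _ n0n).
Qed.

Lemma ideal_of_finite (A : set cantor_space) : A `<=` QQ -> finite_set A ->
  ideal_of R f A.
Proof.
move=> AQ /(@finite_seqP cantor_space)[s As]; apply/ideal_ofP; split=> // k.
have [n0 n0P] := HH_unbounded (k * size s); exists n0 => n /n0P; apply: leq_trans.
rewrite leq_mul2l; apply/orP; right; rewrite -(size_map (prefix_of^~ n)).
by apply: level_le_size => h; rewrite As => hs; apply/mapP; exists h.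
Qed.

Definition zero_ext (s : seq bool) : cantor_space := nth false s.

Lemma zero_ext_QQ s : QQ (zero_ext s).
Proof. by exists (size s) => m; exact: nth_default. Qed.

Lemma zero_ext_prefix_of s : prefix_of (zero_ext s) (size s) = s.
Proof. exact: mkseq_nth. Qed.

Lemma QQ_zero_ext h : QQ h -> exists s, h = zero_ext s.
Proof.
move=> [n hn]; exists (prefix_of h n); apply/funext => i.
rewrite /zero_ext; case: (ltnP i n) => ni; first by rewrite nth_mkseq.
by rewrite hn // nth_default // size_prefix_of.
Qed.

Lemma QQ_not_ideal_of : ~ ideal_of R f QQ.
Proof.
move=> /ideal_ofP[_ /(_ 1%N)[n nP]]; have [_ _ fn] := Hf.
have := nP n (leqnn n); rewrite mul1n; apply/negP; rewrite -ltnNge.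
apply: leq_ltn_trans (fn n) _; apply: (leq_trans (ltn_expl n (ltnSn 1))).
have -> : (2 ^ n = size (strings n))%N.
  by rewrite size_map -cardE card_tuple card_bool.
apply: size_le_level; first exact: uniq_strings.
move=> u; rewrite mem_strings => /eqP <-; exists (zero_ext u).
  exact: zero_ext_QQ.
exact: zero_ext_prefix_of.
Qed.

(** Choose e so that f exceeds k (b k) from e k on. *)
Lemma ideal_of_sparse (b : nat -> nat) : exists e : nat -> nat,
  (forall k, (e k < e k.+1)%N) /\
  forall A, A `<=` QQ ->
    (forall k n, (e k <= n < e k.+1)%N -> (level A n <= b k)%N) ->
    ideal_of R f A.
Proof.
have /choice[g gP] := fun k => HH_unbounded (k * b k)%N.
pose e := fix e k := if k is j.+1 then maxn (e j).+1 (g k) else g 0%N.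
have emono k : (e k < e k.+1)%N by rewrite /= leq_maxl.
have ge k : (g k <= e k)%N by case: k => //= k; exact: leq_maxr.
exists e; split=> // A AQ Ab; apply/ideal_ofP; split=> // k; exists (e k) => n kn.
have [j jP] : exists j, (e j <= n < e j.+1)%N.
  elim: n kn => [|n IH] kn.
    exists k; have := block_start_ge k emono; have := emono k.
    move: kn; rewrite leqn0 => /eqP->.
    by case: (k) => //= j; lia.
  move: kn; rewrite leq_eqVlt => /predU1P[<-|/IH[j /andP[jn nj]]].
    by exists k; rewrite leqnn /=; exact: emono.
  move: nj; rewrite leq_eqVlt => /predU1P[E|nj]; last first.
    by exists j; rewrite nj andbT; exact: ltnW.
  by exists j.+1; rewrite E leqnn /=; exact: emono.
have kj : (k <= j)%N.
  rewrite leqNgt; apply/negP => jk; have := block_start_mono emono jk.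
  by move: jP => /andP[_]; lia.
have := Ab j n jP; have fn : (j * b j <= f n)%N.
  by apply: gP; apply: leq_trans (ge j) _; case/andP: jP.
by move=> lA; apply: leq_trans fn; exact: leq_mul.
Qed.

End LevelIdeal.

(** The points other than y of a finite set stay away from y. *)
Lemma cluster_infinite (A : set cantor_space) y :
  (forall n, exists h, [/\ A h, h <> y & prefix_of h n = prefix_of y n]) ->
  infinite_set A.
Proof.
move=> acc /(@finite_seqP cantor_space)[s As].
have [n nP] : exists n, forall h, h \in s -> h <> y -> prefix_of h n <> prefix_of y n.
  elim: (s) => [|a t [n nP]]; first by exists 0%N.
  have [ay|/eqP ay] := eqVneq a y.
    by exists n => h /[!inE] /predU1P[->//|]; exact: nP.
  have [m am] : exists m, a m <> y m.
    apply: contrapT => na; apply: ay; apply/funext => m; apply: contrapT => am.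
    by apply: na; exists m.
  exists (maxn n m.+1) => h /[!inE] /predU1P[->|ht] hy E.
    by apply: am; move/prefix_ofP: E => -> //; rewrite leq_max ltnSn orbT.
  by apply: (nP h ht hy); apply: prefix_ofW E; exact: leq_maxl.
by have [h [Ah hy /(nP h)]] := acc n; apply => //; rewrite As in Ah.
Qed.

(** Removing finite sets from the members of F generates a proper filter, which has
    a cluster point by compactness. *)
Lemma filter_base_clusters (F : set (set cantor_space)) : filter_base F ->
  (forall A, F A -> infinite_set A) ->
  exists y, forall A, F A -> forall n, exists h,
    [/\ A h, h <> y & prefix_of h n = prefix_of y n].
Proof.
move=> [[A0 FA0] _ Fdir] Finf.
pose G : set_system cantor_space := [set U | exists A E,
  [/\ F A, finite_set E & A `\` E `<=` U]].
have PG : ProperFilter G.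
  split.
    move=> [A [E [FA fE AE]]].
    have [x Ax] := infinite_setN0 (infinite_setD (Finf _ FA) fE).
    exact: AE Ax.
  split.
  - by exists A0, set0.
  - move=> U V [A [E [FA fE AU]]] [B [E' [FB fE' BV]]].
    have [C FC CAB] := Fdir _ _ FA FB; exists C, (E `|` E'); split=> //.
      by rewrite finite_setU.
    move=> x [/CAB[Ax Bx] nE]; split; [apply: AU|apply: BV]; split=> // ?; apply: nE.
      by left.
    by right.
  - by move=> U V UV [A [E [FA fE AU]]]; exists A, E; split=> // x /AU/UV.
have [y [_ clG]] := cantor_space_compact PG filterT.
exists y => A FA n.
have [|h [[Ah hy] hn]] := clG (A `\` [set y]) _ _ (nbhs_prefix_of y n).
  by exists A, [set y]; split=> //; exact: finite_set1.
by exists h.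
Qed.

Section GeLaver.
Variable R : realType.

Lemma HH_id : HH id.
Proof. by split=> // k; exists k.+1. Qed.

(** The complements of the members of the ideal are a witness, so the minimum is
    attained. *)
Lemma ge_ideal_witness f : HH f ->
  let F := ge_ideal QQ (ideal_of R f) in
  [/\ forall A, F A -> A `<=` QQ /\ ~ ideal_of R f A, filter_base F
    & forall A, ideal_of R f A -> exists2 B, F B & finite_set (A `&` B)].
Proof.
move=> Hf /=; rewrite /ge_ideal; set C := [set F | _].
have [|CM _] := @cardinal_minP _ C; last exact: CM.
exists [set QQ `\` A | A in ideal_of R f].
have I0 : ideal_of R f set0 by apply: ideal_of_finite.
have pos A : ideal_of R f A -> ~ ideal_of R f (QQ `\` A).
  move=> IA IQA; apply: (QQ_not_ideal_of (R := R) Hf).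
  apply: ideal_ofW (ideal_of_setU IA IQA) => x Qx.
  by have [Ax|nAx] := pselect (A x); [left|right].
split.
- by move=> _ [A IA <-]; split; [exact: subDsetl|exact: pos].
- split.
  + by exists (QQ `\` set0), set0.
  + by move=> [A IA E]; apply: (pos A IA); rewrite E.
  + move=> _ _ [A IA <-] [B IB <-]; exists (QQ `\` (A `|` B)).
      by exists (A `|` B) => //; exact: ideal_of_setU.
    by move=> x [Qx nAB]; split; split=> // ?; apply: nAB; [left|right].
- move=> A IA; exists (QQ `\` A); first by exists A.
  by rewrite setDE setIA setIC setIA setICl set0I.
Qed.

Lemma ge_LaverE : exists2 f, HH f & ge_Laver R = ge_ideal QQ (ideal_of R f).
Proof.
have [|[f Hf fE] _] :=
  @cardinal_minP _ [set ge_ideal QQ (ideal_of R f) | f in HH]; last first.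
  by exists f; rewrite // fE.
by exists (ge_ideal QQ (ideal_of R id)), id => //; exact: HH_id.
Qed.

Lemma ge_Laver_le f (F : set (set cantor_space)) : HH f ->
  (forall A, F A -> A `<=` QQ /\ ~ ideal_of R f A) -> filter_base F ->
  (forall A, ideal_of R f A -> exists2 B, F B & finite_set (A `&` B)) ->
  (ge_Laver R #<= F)%card.
Proof.
move=> Hf F1 F2 F3.
have [|_ min1] := @cardinal_minP _ [set ge_ideal QQ (ideal_of R f) | f in HH].
  by exists (ge_ideal QQ (ideal_of R id)), id => //; exact: HH_id.
have := min1 _ (ex_intro2 _ _ f Hf erefl); move=> /card_le_trans; apply.
rewrite /ge_ideal; set C := [set G | _].
have [|_ min2] := @cardinal_minP _ C; first by exists F.
exact: min2.
Qed.
End GeLaver.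

(** * Lower bounds for ge *)

Section LowerBounds.
Implicit Types c : cantor_space.
Variables (R : realType) (f : nat -> nat) (F : set (set cantor_space)).
Hypothesis Hf : HH f.
Hypothesis Fpos : forall A, F A -> A `<=` QQ /\ ~ ideal_of R f A.
Hypothesis Fbase : filter_base F.
Hypothesis Fwit : forall A, ideal_of R f A ->
  exists2 B, F B & finite_set (A `&` B).

Lemma positive_base_clusters : exists y, forall A, F A -> forall n,
  exists h, [/\ A h, h <> y & prefix_of h n = prefix_of y n].
Proof.
apply: filter_base_clusters => // A /Fpos[AQ nIA] fA.
by apply: nIA; exact: ideal_of_finite.
Qed.

Lemma no_clustering_member y A : ideal_of R f A ->
  (forall B, F B -> forall n, exists h,
    [/\ A h, B h, h <> y & prefix_of h n = prefix_of y n]) -> False.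
Proof.
move=> /Fwit[B FB fAB] acc; have [] := @cluster_infinite (A `&` B) y _ fAB.
by move=> n; have [h [Ah Bh hy hn]] := acc B FB n; exists h.
Qed.

(** The j-th code consists of j+1 restrictions, so (j+1) 2^j guessed codes yield at
    most (j+1)^2 2^j strings of length e (j+1).  This bound does not depend on e,
    which can therefore be chosen for it in advance. *)
Lemma non_null_additive_le_base : non (null_additive R) #<= F.
Proof.
have [y yF] := positive_base_clusters.
have [e [emono eI]] := ideal_of_sparse R Hf (fun k => (k.+1 * (k.+1 * 2 ^ k)).+1).
have /choice[g gP] : forall p : set cantor_space * nat, exists h, F p.1 ->
    [/\ p.1 h, h <> y & prefix_of h (e p.2) = prefix_of y (e p.2)].
  move=> [A k] /=; have [FA|nFA] := pselect (F A); last by exists y.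
  by have [h hP] := yF A FA (e k); exists h.
pose approx A j := [seq prefix_of (g (A, k)) (e j.+1) | k <- iota 0 j.+1].
pose L j := sumn (nseq j.+1 (e j.+1)).
have shapeE A j : shape (approx A j) = nseq j.+1 (e j.+1).
  rewrite /shape /approx -map_comp (eq_map (g := fun=> e j.+1)).
    by move: (e j.+1) => w; elim: j.+1 0%N => //= n IH i; rewrite IH.
  by move=> k /=; rewrite size_prefix_of.
have flatL A j : F A -> size (flatten (approx A j)) = L j.
  by move=> _; rewrite size_flatten shapeE.
pose X := [set pointer_code L (fun j => flatten (approx A j)) | A in F].
have nX : ~ null_additive R X.
  move=> /(null_additive_slalom flatL)[S [Ssize SP]].
  pose T j := flatten [seq reshape (nseq j.+1 (e j.+1)) p | p <- S j].
  have Tsize j : (size (T j) <= j.+1 * (j.+1 * 2 ^ j))%N.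
    apply: (@leq_trans (j.+1 * size (S j))%N); last by rewrite leq_mul2l Ssize orbT.
    rewrite /T size_flatten /shape -map_comp (eq_map (g := fun=> j.+1)); last first.
      by move=> p /=; rewrite size_reshape size_nseq.
    by elim: (S j) => //= p s; rewrite mulnS leq_add2l.
  pose A : set cantor_space := [set h | QQ h /\
    forall j, prefix_of h (e j.+1) \in prefix_of y (e j.+1) :: T j].
  apply: (@no_clustering_member y A).
    apply: eI => [h []//|k n /andP[_ /ltnW nk]].
    apply: (@leq_trans (size (map (take n) (prefix_of y (e k.+1) :: T k)))).
      apply: level_le_size => h [_ /(_ k) hk].
      by rewrite -(take_prefix_of _ nk); exact: map_f.
    by rewrite size_map /= ltnS.
  move=> B FB n; have [m mP] := SP B FB; pose k := maxn n m.
  have [Bg gy gk] := gP (B, k) FB; exists (g (B, k)); split=> //; last first.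
    apply: prefix_ofW gk; apply: leq_trans (block_start_ge _ emono).
    exact: leq_maxl.
  split=> [|j]; first by have [BQ _] := Fpos FB; exact: BQ.
  rewrite inE; have [jk|kj] := ltnP j k.
    apply/orP; left; apply/eqP; apply: prefix_ofW gk.
    exact: block_start_mono.
  apply/orP; right; apply/flattenP; exists (approx B j).
    apply/mapP; exists (flatten (approx B j)).
      by apply: mP; apply: leq_trans kj; exact: leq_maxr.
    by rewrite -(shapeE B) flattenK.
  by apply/mapP; exists k => //; rewrite mem_iota.
have [|_ min] := @cardinal_minP _ [set X | ~ null_additive R X]; first by exists X.
exact: card_le_trans (min _ nX) (card_image_le _ _).
Qed.

(** Infinite sequences of zeros appended to the strings exhaust the rationals. *)
Definition enum_QQ (i : nat) : cantor_space := zero_ext (odflt [::] (unpickle i)).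

Lemma enum_QQ_onto h : QQ h -> exists i, enum_QQ i = h.
Proof.
by move=> /QQ_zero_ext[s ->]; exists (pickle s); rewrite /enum_QQ pickleK.
Qed.

(** The term of index i is selected by c if c i holds and the term agrees with y up
    to e k, where k counts the earlier i' with c i'.  As each k occurs for a single
    i, the selected set has level at most k + 2 below e (k+1); and every finite part
    of c can be prolonged so as to select a new member of a given B. *)
Lemma cov_meager_le_base : cov_meager #<= F.
Proof.
have [y yF] := positive_base_clusters.
have [e [emono eI]] := ideal_of_sparse R Hf (fun k => k.+2).
pose cnt c i := count c (iota 0 i).
pose sel c i := c i /\ prefix_of (enum_QQ i) (e (cnt c i)) = prefix_of y (e (cnt c i)).
have cnt_mono c i j : (i <= j)%N -> (cnt c i <= cnt c j)%N.
  by move=> ij; rewrite /cnt -(subnKC ij) iotaD count_cat leq_addr.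
have cntS c i : cnt c i.+1 = (cnt c i + c i)%N.
  by rewrite /cnt -addn1 iotaD count_cat /= add0n addn0.
have cnt_inj c i j : c i -> c j -> cnt c i = cnt c j -> i = j.
  wlog ij : i j / (i <= j)%N => [wl ci cj E|ci cj E].
    by case/orP: (leq_total i j) => [/wl|/wl/(_ cj ci (esym E))->//]; apply.
  apply/eqP; rewrite eqn_leq ij leqNgt; apply/negP => ji; have := cnt_mono c _ _ ji.
  by rewrite cntS ci E; lia.
pose A c : set cantor_space := [set h | QQ h /\ exists2 i, sel c i & enum_QQ i = h].
have IA c : ideal_of R f (A c).
  apply: eI => [h []//|k n /andP[_ nk]].
  have /choice[q qP] : forall j, exists i, forall i', c i' -> cnt c i' = j -> i' = i.
    move=> j; have [[i [ci ij]]|ni] := pselect (exists i, c i /\ cnt c i = j).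
      by exists i => i' ci' i'j; apply: (cnt_inj c) => //; rewrite i'j.
    by exists 0%N => i ci ij; case: ni; exists i.
  apply: (@leq_trans (size (prefix_of y n ::
      [seq prefix_of (enum_QQ (q j)) n | j <- iota 0 k.+1]))); last first.
    by rewrite /= size_map size_iota.
  apply: level_le_size => h [_ [i [ci yi] <-]]; rewrite inE.
  have [ik|ki] := ltnP (cnt c i) k.+1; apply/orP; [right|left].
    by apply/mapP; exists (cnt c i); rewrite ?mem_iota // -(qP _ i).
  apply/eqP; apply: prefix_ofW yi; apply: (leq_trans (ltnW nk)).
  exact: block_start_mono.
pose N B m : set cantor_space :=
  [set c | forall i, (m <= i)%N -> sel c i -> B (enum_QQ i) -> enum_QQ i = y].
have Nnd B m : F B -> nowhere_dense (N B m).
  move=> FB; rewrite /nowhere_dense -subset0 => x /nbhs_cantorE[n nP].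
  pose M := maxn n m; pose k := cnt x M.
  have infB : infinite_set [set h | [/\ B h, h <> y &
      prefix_of h (e k) = prefix_of y (e k)]].
    apply: (@cluster_infinite _ y) => j.
    have [h [Bh hy hj]] := yF B FB (maxn j (e k)); exists h; split=> //.
      by split=> //; apply: prefix_ofW hj; exact: leq_maxr.
    by apply: prefix_ofW hj; exact: leq_maxl.
  have [i Mi [Bi iy ik]] : exists2 i, (M <= i)%N & [/\ B (enum_QQ i),
      enum_QQ i <> y & prefix_of (enum_QQ i) (e k) = prefix_of y (e k)].
    apply: contrapT => ni; apply: infB.
    apply: (@sub_finite_set _ _ [set enum_QQ i | i in `I_M]).
      move=> h [Bh hy hk]; have [BQ _] := Fpos FB.
      have [i ih] := enum_QQ_onto (BQ _ Bh); exists i => //=.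
      by rewrite ltnNge; apply/negP => Mi; apply: ni; exists i; rewrite // ih.
    by apply: finite_image; exact: finite_II.
  (* below M, c is in the given neighbourhood; its next selected term is the i-th *)
  pose c : cantor_space := fun j => if (j < M)%N then x j else j == i.
  have cx : prefix_of c n = prefix_of x n.
    by apply/prefix_ofP => j jn; rewrite /c leq_max jn.
  have [c' [c'N /prefix_ofP c'c]] := nP c cx _ (nbhs_prefix_of c i.+1).
  have cnt_c' : cnt c' i = k.
    rewrite /cnt /k -(subnKC Mi) iotaD count_cat add0n.
    rewrite [X in (_ + X)%N](_ : _ = 0%N) ?addn0.
      apply: eq_in_count => j; rewrite mem_iota add0n => /andP[_ jM].
      by rewrite c'c /c ?jM //; lia.
    rewrite (eq_in_count (a2 := pred0)) ?count_pred0 // => j.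
    rewrite mem_iota subnKC // => /andP[Mj ji].
    by rewrite c'c ?ltnS ?(ltnW ji) // /c ltnNge Mj /= ltn_eqF.
  apply: iy; apply: (c'N i) => //; first by apply: leq_trans Mi; exact: leq_maxr.
  by split; [rewrite c'c // /c ltnNge Mi /= eqxx|rewrite cnt_c'].
pose G := [set \bigcup_m N B m | B in F].
have cG : [set H | H `<=` @meager cantor_space /\ \bigcup_(X in H) X = setT] G.
  split=> [_ [B FB <-]|].
    by exists (N B) => // m; exact: Nnd.
  apply/seteqP; split=> // c _; apply: contrapT => nc.
  apply: (@no_clustering_member y (A c) (IA c)) => B FB n.
  have cm m : exists i, [/\ (m <= i)%N, sel c i, B (enum_QQ i) & enum_QQ i <> y].
    apply: contrapT => ni; apply: nc; exists (\bigcup_m N B m); first by exists B.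
    exists m => // i mi si Bi; apply: contrapT => iy; apply: ni.
    by exists i.
  have [m mn] : exists m, (n <= cnt c m)%N.
    elim: n => [|n [m mn]]; first by exists 0%N.
    have [i [mi [ci _] _ _]] := cm m; exists i.+1.
    by rewrite cntS ci addn1 ltnS (leq_trans mn) // cnt_mono.
  have [i [mi [ci iy] Bi niy]] := cm m; exists (enum_QQ i); split=> //.
    by split; [exact: zero_ext_QQ|exists i].
  apply: prefix_ofW iy; apply: leq_trans (block_start_ge _ emono).
  by apply: leq_trans mn _; exact: cnt_mono.
have [|_ min] := @cardinal_minP _
  [set H | H `<=` @meager cantor_space /\ \bigcup_(X in H) X = setT]; first by exists G.
exact: card_le_trans (min _ cG) (card_image_le _ _).
Qed.
End LowerBounds.

(** * Upper bounds for ge *)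

Section UpperBounds.
Variables (R : realType) (m : nat -> nat).

(** The lists S i collect what a member of the ideal can list in the i-th block,
    from the block J on where its level obeys the bound. *)
Definition escapes (X : set cantor_space) (D : set (nat -> nat)) : Prop :=
  forall (S : nat -> seq (seq bool)) J, (forall i, size (S i) <= i.+1 * i.+1)%N ->
  exists2 x, X x & exists2 d, D d & forall j, exists i,
    [/\ (j <= i < d j)%N, (J <= i)%N & prefix_of x (m i) \notin S i].

(** The i-th block has a flag bit, which marks it as used, and room for i strings of
    length m i. *)
Fixpoint code_start i : nat :=
  if i is j.+1 then (code_start j + (j * m j).+1)%N else 0%N.

Lemma code_start_lt i : (code_start i < code_start i.+1)%N.
Proof. by rewrite /= addnS ltnS leq_addr. Qed.

Definition decode i (z : nat -> bool) : seq (seq bool) :=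
  [seq mkseq (fun t => z ((code_start i).+1 + k * m i + t)%N) (m i) | k <- iota 0 i].

Definition guesses (w : cantor_space * (nat -> nat)) : set cantor_space :=
  [set h | exists j, (forall p, (p < code_start j)%N -> h p = false) /\
     forall i, (j <= i < w.2 j)%N ->
       h (code_start i) /\ prefix_of w.1 (m i) \in decode i h].

Definition all_guess (Y : seq (cantor_space * (nat -> nat))) : set cantor_space :=
  [set h | QQ h /\ all (fun w => `[< guesses w h >]) Y].

(** A rational that vanishes before the j-th block, and lists in each later block
    the restrictions of all the points of Y, up to a block M that lies beyond all
    the intervals [j, d j) that have to be served. *)
Definition encode (Y : seq (cantor_space * (nat -> nat))) (j : nat) : cantor_space :=
  let w0 := (fun=> false, fun=> 0%N) in
  let M := maxn j.+1 (\max_(k < size Y) (nth w0 Y k).2 j) in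
  fun p => let i := block_index code_start p in
    let o := (p - (code_start i).+1)%N in
    (code_start j <= p < code_start M)%N &&
    ((p == code_start i) || (nth w0 Y (o %/ m i)).1 (o %% m i)%N).

Lemma encode_low Y j p : (p < code_start j)%N -> encode Y j p = false.
Proof. by move=> pj; rewrite /encode /= leqNgt pj. Qed.

Lemma encode_flag Y j i :
  (j <= i < maxn j.+1 (\max_(k < size Y) (nth (fun=> false, fun=> 0%N) Y k).2 j))%N ->
  encode Y j (code_start i).
Proof.
move=> /andP[ji iM]; rewrite /encode /= (@block_indexE _ i); first last.
- by rewrite leqnn code_start_lt.
- exact: code_start_lt.
rewrite eqxx /= (block_start_mono code_start_lt ji) andbT.
apply: leq_trans (code_start_lt i) _.
exact: block_start_mono code_start_lt _.
Qed.

Lemma encode_guess Y j : (size Y <= j)%N -> all_guess Y (encode Y j).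
Proof.
set w0 : cantor_space * (nat -> nat) := (fun=> false, fun=> 0%N).
set M := maxn j.+1 (\max_(k < size Y) (nth w0 Y k).2 j).
move=> Yj; split.
  exists (code_start M) => p Mp; rewrite /encode /= -/w0 -/M.
  by rewrite [(p < _)%N]ltnNge Mp andbF.
apply/(all_nthP w0) => k kY; apply/asboolP; exists j; split=> [p|i /andP[ji id]].
  exact: encode_low.
have iM : (i < M)%N.
  apply: leq_trans id _; rewrite /M leq_max; apply/orP; right.
  exact: (@leq_bigmax_cond _ xpredT (fun k : 'I_(size Y) => (nth w0 Y k).2 j)
    (Ordinal kY)).
split; first by apply: encode_flag; rewrite ji.
apply/mapP; exists k; first by rewrite mem_iota /=; lia.
apply/eq_mkseqP => t tm; rewrite /encode; cbv zeta; rewrite -/w0 -/M.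
have ki : (k.+1 * m i <= i * m i)%N.
  by rewrite leq_mul2r (leq_trans kY) ?orbT // (leq_trans Yj).
rewrite mulSn in ki.
rewrite (@block_indexE _ i); first last.
- by rewrite /=; lia.
- exact: code_start_lt.
have -> : ((code_start i).+1 + k * m i + t - (code_start i).+1 = k * m i + t)%N by lia.
have m0 : (0 < m i)%N by lia.
rewrite divnMDl // modnMDl divn_small // modn_small // addn0.
have -> : (code_start j <= (code_start i).+1 + k * m i + t)%N.
  by apply: leq_trans (block_start_mono code_start_lt ji) _; lia.
have -> : ((code_start i).+1 + k * m i + t < code_start M)%N.
  apply: leq_trans (block_start_mono code_start_lt iM); rewrite /=; lia.
by rewrite (_ : (_ == _) = false) //; apply/eqP; lia.
Qed.

(** For size Y <= j < n, the rationals [encode Y j] are told apart below the n-th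
    block by the position of their first flag. *)
Lemma level_all_guess Y n : (n - size Y <= level (all_guess Y) (code_start n))%N.
Proof.
have -> : (n - size Y = size [seq prefix_of (encode Y j) (code_start n) |
    j <- iota (size Y) (n - size Y)])%N by rewrite size_map size_iota.
apply: size_le_level; last first.
  move=> u /mapP[j]; rewrite mem_iota => /andP[Yj _] ->.
  by exists (encode Y j) => //; exact: encode_guess.
have lt_neq j j' : (j < j' < n)%N -> prefix_of (encode Y j) (code_start n) <>
    prefix_of (encode Y j') (code_start n).
  move=> /andP[jj' j'n] /prefix_ofP/(_ (code_start j)).
  rewrite encode_flag ?leqnn ?leq_max ?ltnSn // encode_low.
    suff jn : (code_start j < code_start n)%N by move=> /(_ jn).
    apply: leq_trans (code_start_lt j) _.
    exact: block_start_mono code_start_lt (ltn_trans jj' j'n).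
  by apply: leq_trans (code_start_lt j) _; exact: block_start_mono code_start_lt _.
rewrite map_inj_in_uniq ?iota_uniq // => j j'; rewrite !mem_iota => jn j'n E.
have [jj'|j'j|//] := ltngtP j j'; exfalso.
  by apply: lt_neq E; rewrite jj' /=; lia.
by apply: lt_neq (esym E); rewrite j'j /=; lia.
Qed.

(** At the start of the n-th block f is n and the level is at least n - size Y, so
    the level exceeds f / 2 infinitely often. *)
Lemma all_guess_positive Y : ~ ideal_of R (block_index code_start) (all_guess Y).
Proof.
move=> /ideal_ofP[_ /(_ 2)[n0 n0P]]; pose n := maxn n0 (size Y).*2.+1.
have /n0P : (n0 <= code_start n)%N.
  by apply: leq_trans (block_start_ge _ code_start_lt); exact: leq_maxl.
rewrite (@block_indexE _ n) ?leqnn ?code_start_lt //; last exact: code_start_lt.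
have := level_all_guess Y n; have : ((size Y).*2.+1 <= n)%N by exact: leq_maxr.
by rewrite -mul2n; lia.
Qed.

(** Let f count the blocks.  The sets [all_guess Y], for finite sequences Y in the
    product of X and D, are closed under intersection and positive.  For A in the
    ideal, the lists in the i-th block of members of A have at most (i+1) i entries,
    for i large; if (x, d) escapes them, no member of A guesses (x, d). *)
Lemma ge_Laver_le_escaping X D T (U : set T) : infinite_set U ->
  X #<= U -> D #<= U -> escapes X D -> ge_Laver R #<= U.
Proof.
move=> Uinf XU DU esc.
pose F := [set all_guess Y | Y in [set Y | all (fun w => `[< (X `*` D) w >]) Y]].
have HF : HH (block_index code_start) by exact: block_index_HH code_start_lt _.
apply: (@card_le_trans _ _ _ F); last first.
  apply: card_le_trans (card_image_le _ _) _.
  by apply: card_seq_le => //; exact: card_prod_le.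
apply: (ge_Laver_le HF).
- by move=> _ [Y _ <-]; split; [move=> h []|exact: all_guess_positive].
- split.
  + by exists (all_guess [::]), [::].
  + move=> [Y _ E]; apply: (@all_guess_positive Y); rewrite E.
    exact: ideal_of_finite.
  + move=> _ _ [Y XY <-] [Y' XY' <-]; exists (all_guess (Y ++ Y')).
      by exists (Y ++ Y') => //=; rewrite all_cat XY.
    by move=> h [Qh]; rewrite all_cat => /andP[Yh Y'h]; split; split.
- move=> A /ideal_ofP[AQ /(_ 1)[J JP]].
  pose V i := finmap.enum_fset (fset_set [set prefix_of h (code_start i.+1) | h in A]).
  pose S i :=
    if (J <= i)%N then flatten [seq decode i (nth false v) | v <- V i] else [::].
  have Ssize i : (size (S i) <= i.+1 * i.+1)%N.
    rewrite /S; case: ifP => // Ji.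
    rewrite size_flatten /shape -map_comp (eq_map (g := fun=> i)); last first.
      by move=> v /=; rewrite size_map size_iota.
    rewrite (_ : sumn _ = size (V i) * i)%N; last first.
      by elim: (V i) => //= v s ->; rewrite mulSn.
    apply: leq_mul => //; have := JP (code_start i.+1); rewrite mul1n.
    rewrite (@block_indexE _ i.+1) ?leqnn ?code_start_lt //; last exact: code_start_lt.
    apply; apply: leq_trans Ji _; apply: leq_trans (block_start_ge _ code_start_lt).
    exact: leqnSn.
  have [x Xx [d Dd xd]] := esc S J Ssize.
  exists (all_guess [:: (x, d)]).
    by exists [:: (x, d)] => //=; rewrite andbT; apply/asboolP.
  suff -> : A `&` all_guess [:: (x, d)] = set0 by exact: finite_set0.
  rewrite -subset0 => h [Ah [_ /=]]; rewrite andbT => /asboolP[j [_ jP]].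
  have [i [ji Ji /negP]] := xd j; apply; have [_] := jP i ji.
  rewrite /S Ji => xi; apply/flattenP.
  exists (decode i (nth false (prefix_of h (code_start i.+1)))).
    apply/mapP; exists (prefix_of h (code_start i.+1)) => //.
    rewrite /V in_fset_set; last exact: finite_prefixes.
    by apply/mem_set; exists h.
  move: xi => /mapP[k ki ->]; apply/mapP; exists k => //.
  apply/eq_mkseqP => t tm; rewrite nth_mkseq //=.
  move: ki; rewrite mem_iota add0n => /andP[_ ki].
  have : (k.+1 * m i <= i * m i)%N by rewrite leq_mul2r ki orbT.
  by rewrite mulSn; lia.
Qed.

(** Lists of size (i+1)^2 have room for all the restrictions of the points of a
    finite set. *)
Lemma escaping_infinite X D : escapes X D -> infinite_set X.
Proof.
move=> esc /(@finite_seqP cantor_space)[s Xs].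
pose S i := if (size s <= i)%N then [seq prefix_of x (m i) | x <- s] else [::].
have [|x Xx [d _ /(_ 0%N)[i [_ si]]]] := esc S (size s).
  move=> i; rewrite /S; case: ifP => // si; rewrite size_map mulnS (leq_trans si) //.
  by rewrite (leq_trans (leqnSn i)) ?leq_addr.
rewrite /S si => /negP; apply; apply/mapP; exists x => //.
by move: Xx; rewrite Xs.
Qed.
End UpperBounds.

(** * Strong measure zero and the ideal E *)

Section Null.
Variable R : realType.
Local Open Scope ring_scope.

Lemma null_sigma_ideal : sigma_ideal (@null R).
Proof.
split.
- by apply/nullP => e; exact: covered_set0.
- by move=> A B AB /nullP nB; apply/nullP => e /nB; exact: coveredW.
- move=> A nA; apply/nullP => e e0.
  apply: (@covered_bigcup R A (fun n => e / (2 ^ n.+1)%:R)).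
    move=> n; move/nullP: (nA n); apply.
    by rewrite divr_gt0 // ltr0n expn_gt0.
  by apply: epsilon_trick0; exact: ltW.
Qed.

Lemma setT_not_null : ~ null R [set: cantor_space].
Proof. by move=> /null_outer T0; have := outer_setT R; rewrite T0 ler10. Qed.

Lemma setT_not_strong_measure_zero : ~ strong_measure_zero [set: cantor_space].
Proof.
move=> /(_ (fun n => n.+2))[s sn sT]; have := outer_setT R.
suff /outer_le : covered [set: cantor_space] (2^-1 : R) by lra.
exists s => //; apply: le_trans (epsilon_trick0 xpredT (_ : 0 <= 2^-1)) => //.
apply: lee_nneseries => [k _ _|k _]; first by rewrite lee_fin weight_ge0.
by rewrite lee_fin sn exprS natrX -exprVn.
Qed.

Lemma idealE_null : idealE R `<=` @null R.
Proof.
move=> A; apply; split; first exact: null_sigma_ideal.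
move=> B; have [_ nW _] := null_sigma_ideal; apply: nW.
exact: subset_closure.
Qed.

Lemma outer_prefixes (A : set cantor_space) m (s : seq (seq bool)) :
  (forall x, A x -> prefix_of x m \in s) -> outer R A <= (size s)%:R * 2^-1 ^+ m.
Proof.
elim: s A => [|v s IH] A As.
  have -> : A = set0 by rewrite -subset0 => x /As.
  by rewrite outer_set0 mul0r.
pose A1 := [set x | prefix_of x m = v].
have A1m : outer R A1 <= 2^-1 ^+ m.
  have [vm|vm] := eqVneq (size v) m.
    apply: le_trans (_ : outer R (cylinder v) <= _); last by rewrite -vm outer_cylinder.
    by apply: le_outer => x; rewrite /A1 /cylinder/= vm.
  have -> : A1 = set0.
    rewrite -subset0 => x xv; move: vm; rewrite -(xv : prefix_of x m = v).
    by rewrite size_prefix_of eqxx.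
  by rewrite outer_set0 weight_ge0.
have : outer R (A `&` [set x | prefix_of x m \in s]) <= (size s)%:R * 2^-1 ^+ m.
  by apply: IH => x [].
suff : outer R A <= outer R A1 + outer R (A `&` [set x | prefix_of x m \in s]).
  rewrite [size _]/= -[(size s).+1%:R]natr1 mulrDl mul1r; lra.
apply: le_trans (outer_setU _ _ _); apply: le_outer => x Ax.
by have := As x Ax; rewrite inE => /predU1P[|xs]; [left|right].
Qed.

(** For each n the points captured from n on form a closed set, which is covered by
    (i+1)^2 <= 4^i cylinders of weight 8^-i for every i >= n. *)
Lemma idealE_captured (S : nat -> seq (seq bool)) (X : set cantor_space) :
  (forall i, size (S i) <= i.+1 * i.+1)%N ->
  (forall x, X x -> exists J, forall i, (J <= i)%N -> prefix_of x (3 * i) \in S i) ->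
  idealE R X.
Proof.
move=> Ssize XS J [[_ JW Jbigcup] Jnull].
pose C n := [set x | forall i, (n <= i)%N -> prefix_of x (3 * i) \in S i].
apply: (@JW _ (\bigcup_n C n)); first by move=> x /XS[n xn]; exists n.
apply: Jbigcup => n; apply: Jnull; rewrite /=.
have /closure_id <- : closed (C n).
  have -> : C n = \bigcap_(i in [set i | (n <= i)%N])
      [set x | prefix_of x (3 * i) \in S i].
    by apply/seteqP; split.
  by apply: closed_bigI => i _; exact: (@closed_prefix_of (fun u => u \in S i)).
apply/null_outer/eqP; rewrite eq_le outer_ge0 andbT; apply/ler_addgt0Pr => e e0.
rewrite add0r; have [k ke] := weight_small e0.
pose i := maxn n k; have ni : (n <= i)%N by exact: leq_maxl.
apply: le_trans (@outer_prefixes (C n) (3 * i) (S i) _) _ => [x|]; first exact.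
apply: le_trans (ltW ke); apply: (@le_trans _ _ (2^-1 ^+ i : R)); last first.
  apply: ler_wiXn2l => //; last exact: leq_maxr.
  by rewrite invf_le1 ?ler1n.
apply: (@le_trans _ _ (((2 ^ i) * (2 ^ i))%:R * 2^-1 ^+ (3 * i))).
  rewrite ler_wpM2r ?weight_ge0 // ler_nat; apply: leq_trans (Ssize i) _.
  by apply: leq_mul; exact: ltn_expl.
have two : 2 ^+ i * 2^-1 ^+ i = 1 :> R by rewrite -exprMn mulfV // expr1n.
rewrite natrM !natrX mulnC exprM; set a := 2 ^+ i in two *; set b := 2^-1 ^+ i in two *.
have -> : a * a * b ^+ 3 = (a * b) ^+ 2 * b.
  by rewrite exprMn !expr2 !exprS expr0 mulr1 !mulrA.
by rewrite two expr1n mul1r.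
Qed.

End Null.

(** * The four inequalities *)

Section Upper.
Variable R : realType.

(** If X is not of strong measure zero for the lengths g, let m i be the largest of
    the (i+1)^2 lengths g (i, t): then lists of (i+1)^2 strings of length m i cannot
    capture all of X, since enumerating them by the pairs (i, t) would give a cover
    that g forbids. *)
Lemma ge_Laver_le_non_SN : ge_Laver R #<= non strong_measure_zero.
Proof.
have [|nX _] := @cardinal_minP _ [set X | ~ strong_measure_zero X].
  by exists setT; exact: (@setT_not_strong_measure_zero R).
rewrite -/(non strong_measure_zero) in nX *; set X := non _ in nX *.
have [g gX] : exists g : nat -> nat, forall s, (forall n, size (s n) = g n) ->
    ~ (X `<=` \bigcup_n cylinder (s n)).
  apply: contrapT => ng; apply: nX => g; apply: contrapT => ns; apply: ng.
  by exists g => s sg Xs; apply: ns; exists s.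
pose m i := \max_(t < i.+1 * i.+1) g (pickle (i, t : nat)).
pose D := range (fun n j => (maxn j n).+1).
have esc : escapes m X D.
  move=> S J Ssize.
  pose s n := mkseq (nth false (let p : nat * nat := odflt (0%N, 0%N) (unpickle n) in
    nth [::] (S p.1) p.2)) (g n).
  have [x Xx xs] : exists2 x, X x & forall n, ~ cylinder (s n) x.
    apply: contrapT => nx; apply: (gX s); first by move=> n; rewrite size_mkseq.
    move=> x Xx; apply: contrapT => xs; apply: nx; exists x => // n xn.
    by apply: xs; exists n.
  exists x => //; exists (fun j => (maxn j J).+1); first by exists J.
  move=> j; exists (maxn j J); split; [by rewrite leq_maxl /=|exact: leq_maxr|].
  move: (maxn j J) => i; apply/negP => /(nthP [::])[t tS xt].
  apply: (xs (pickle (i, t))); apply/cylinderP => p; rewrite size_mkseq => pg.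
  rewrite nth_mkseq // pickleK /= xt nth_mkseq //; apply: leq_trans pg _.
  have tb : (t < i.+1 * i.+1)%N by exact: leq_trans tS (Ssize i).
  exact: (@leq_bigmax_cond _ xpredT (fun t : 'I__ => g (pickle (i, t : nat)))
    (Ordinal tb)).
have Xinf := escaping_infinite esc.
apply: (ge_Laver_le_escaping R Xinf (card_lexx _) _ esc).
by apply: card_le_trans (card_image_le _ _) _; exact/infiniteP.
Qed.

(** If X is not in E, some x in X escapes the lists infinitely often; let g j be an
    escape after j.  A member d of the dominating family bounds g almost
    everywhere, and everywhere once it is raised to a constant. *)
Lemma ge_Laver_le_max :
  ge_Laver R #<= cardinal_max (non (idealE R)) dominating_number.
Proof.
have [|nX _] := @cardinal_minP _ [set X | ~ idealE R X].
  by exists setT => /idealE_null; exact: setT_not_null.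
rewrite -/(non (idealE R)) in nX *; set X := non _ in nX *.
have [|Ddom _] := @cardinal_minP _ [set F : set (nat -> nat) |
    forall g, exists2 f, F f & \forall n \near \oo, (g n <= f n)%N].
  by exists setT => g; exists g => //; exists 0%N.
rewrite -/dominating_number in Ddom *; set D := dominating_number in Ddom *.
have [XU DU] := card_le_max X D; set U := cardinal_max X D in XU DU *.
pose D' := [set (fun j => (maxn (d.1 j) d.2).+1) | d in D `*` [set: nat]].
have esc : escapes (fun i => 3 * i)%N X D'.
  move=> S J Ssize.
  have [x Xx xS] : exists2 x, X x &
      forall j, exists i, (j <= i)%N /\ prefix_of x (3 * i) \notin S i.
    apply: contrapT => nx; apply: nX; apply: (@idealE_captured R S) => // x Xx.
    apply: contrapT => xS; apply: nx; exists x => // j; apply: contrapT => ni.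
    apply: xS; exists j => i ji; apply: contrapT => /negP xi.
    by apply: ni; exists i.
  have /choice[g gP] := fun j => xS (maxn j J).
  have [d Dd [n0 _ n0P]] := Ddom g.
  exists x => //; exists (fun j => (maxn (d j) (\max_(i < n0) g i)).+1).
    by exists (d, \max_(i < n0) g i).
  move=> j; exists (g j); have [jg gS] := gP j.
  split=> //; last by apply: leq_trans jg; exact: leq_maxr.
  rewrite (leq_trans (leq_maxl j J)) //= ltnS leq_max.
  case: (leqP n0 j) => nj; first by rewrite (n0P j nj).
  by rewrite (@leq_bigmax_cond _ xpredT (fun i : 'I_n0 => g i) (Ordinal nj)) ?orbT.
have Xinf := escaping_infinite esc.
have Uinf : infinite_set U by move=> /(card_le_finite XU).
apply: (ge_Laver_le_escaping R Uinf XU _ esc).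
apply: card_le_trans (card_image_le _ _) _.
by apply: card_prod_le => //; exact/infiniteP.
Qed.
End Upper.

Theorem corollary4p13 (R : realType) :
  [/\ cov_meager #<= ge_Laver R,
      non (null_additive R) #<= ge_Laver R,
      ge_Laver R #<= non strong_measure_zero
    & ge_Laver R #<= cardinal_max (non (idealE R)) dominating_number].
Proof.
have [f Hf fE] := ge_LaverE R.
have [Fpos Fbase Fwit] := ge_ideal_witness R Hf.
split.
- by rewrite fE; exact: (cov_meager_le_base Hf Fpos Fbase Fwit).
- by rewrite fE; exact: (non_null_additive_le_base Hf Fpos Fbase Fwit).
- exact: ge_Laver_le_non_SN.
- exact: ge_Laver_le_max.
Qed.
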